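(* Let $\alpha = a + b\rho$ be a nonzero element of $\mathbb{Z}[\rho]$ with $a, b \in \mathbb{Z}$ and $0 \le a \le b$, where $\rho = (1+i\sqrt{3})/2$. Let $EJ_\alpha$ be the Eisenstein-Jacobi network generated by $\alpha$, and let $n = a^2 + b^2 + ab$ be its number of nodes. Then $EJ_\alpha$ is panconnected: for every two distinct nodes $u$ and $v$ of $EJ_\alpha$ and every integer $l$ with $D(u,v) \le l \le n-1$, there is a path from $u$ to $v$ in $EJ_\alpha$ of length exactly $l$, where $D(u,v)$ denotes the length of a shortest path between $u$ and $v$.
   Context: Let $\rho = (1+i\sqrt{3})/2$, so that $\rho^2 = \rho - 1$, and let $\mathbb{Z}[\rho] = \{x + y\rho \mid x, y \in \mathbb{Z}\}$ be the ring of Eisenstein-Jacobi integers. For nonzero $\alpha = a + b\rho \in \mathbb{Z}[\rho]$ with $0 \le a \le b$, the Eisenstein-Jacobi (EJ) network $EJ_\alpha$ is the undirected graph whose node set is the quotient ring $\mathbb{Z}[\rho]_\alpha = \mathbb{Z}[\rho]/(\alpha)$, which has $N(\alpha) = a^2 + b^2 + ab$ elements, and in which two nodes $\beta, \gamma$ are adjacent if and only if $\beta - \gamma$ is congruent modulo $\alpha$ to one of $1, -1, \rho, -\rho, \rho^2, -\rho^2$. A path visits no node more than once, and its length is its number of edges. *)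

(* Defs.v *)
From HB Require Import structures.
From mathcomp Require Import all_boot all_order all_algebra all_field.
From mathcomp Require Import generic_quotient ring_quotient ring boolp.
Set Implicit Arguments.
Unset Strict Implicit.
Unset Printing Implicit Defensive.
Import Order.TTheory GRing.Theory Num.Theory.
Local Open Scope ring_scope.
Local Open Scope quotient_scope.

(* Eis x y stands for x + y * rho; [eisC] below is the injective ring morphism
   to the algebraic complex numbers that sends it there. *)
Record eisenstein := Eis { eis1 : int; eisrho : int }.

Definition eis_pair (z : eisenstein) : int * int := (eis1 z, eisrho z).
Definition pair_eis (p : int * int) : eisenstein := Eis p.1 p.2.
Lemma eis_pairK : cancel eis_pair pair_eis. Proof. by case. Qed.

HB.instance Definition _ := Countable.copy eisenstein (can_type eis_pairK).

Definition eis_add (z w : eisenstein) : eisenstein :=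
  Eis (eis1 z + eis1 w) (eisrho z + eisrho w).
Definition eis_opp (z : eisenstein) : eisenstein := Eis (- eis1 z) (- eisrho z).

Lemma eis_addA : associative eis_add.
Proof. by move=> [? ?] [? ?] [? ?]; congr Eis; rewrite /= addrA. Qed.
Lemma eis_addC : commutative eis_add.
Proof. by move=> [? ?] [? ?]; congr Eis; rewrite /= addrC. Qed.
Lemma eis_add0 : left_id (Eis 0 0) eis_add.
Proof. by move=> [? ?]; congr Eis; rewrite /= add0r. Qed.
Lemma eis_addN : left_inverse (Eis 0 0) eis_opp eis_add.
Proof. by move=> [? ?]; congr Eis; rewrite /= addNr. Qed.

HB.instance Definition _ :=
  GRing.isZmodule.Build eisenstein eis_addA eis_addC eis_add0 eis_addN.

(* (x + y rho)(x' + y' rho), reduced with rho^2 = rho - 1. *)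
Definition eis_mul (z w : eisenstein) : eisenstein :=
  Eis (eis1 z * eis1 w - eisrho z * eisrho w)
      (eis1 z * eisrho w + eisrho z * eis1 w + eisrho z * eisrho w).

Lemma eis_mulA : associative eis_mul.
Proof. by move=> [? ?] [? ?] [? ?]; congr Eis; rewrite /=; ring. Qed.
Lemma eis_mulC : commutative eis_mul.
Proof. by move=> [? ?] [? ?]; congr Eis; rewrite /=; ring. Qed.
Lemma eis_mul1 : left_id (Eis 1 0) eis_mul.
Proof. by move=> [? ?]; congr Eis; rewrite /=; ring. Qed.
Lemma eis_mulDl : left_distributive eis_mul +%R.
Proof. by move=> [? ?] [? ?] [? ?]; congr Eis; rewrite /=; ring. Qed.
Lemma eis_1neq0 : Eis 1 0 != 0.
Proof. by []. Qed.

HB.instance Definition _ := GRing.Zmodule_isComNzRing.Build eisenstein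
  eis_mulA eis_mulC eis_mul1 eis_mulDl eis_1neq0.

Definition rho : eisenstein := Eis 0 1.

Lemma rho2 : rho ^+ 2 = rho - 1.
Proof. by []. Qed.

Lemma EisE (x y : int) : Eis x y = x%:~R + y%:~R * rho.
Proof.
have h1 (n : nat) : (1 : eisenstein) *+ n = Eis n 0.
  elim: n => [|n IH]; first by [].
  by rewrite mulrS IH; congr Eis.
have hz (z : int) : (z%:~R : eisenstein) = Eis z 0.
  case: z => n; first by rewrite -h1.
  by rewrite NegzE mulrNz -[_%:~R]/(1 *+ n.+1) h1; congr Eis.
by rewrite !hz; congr Eis; rewrite /=; ring.
Qed.

Definition rhoC : algC := (1 + 'i * sqrtC 3) / 2.
Definition eisC (z : eisenstein) : algC :=
  (eis1 z)%:~R + (eisrho z)%:~R * rhoC.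

Lemma rhoC2 : rhoC ^+ 2 = rhoC - 1.
Proof.
have h : ('i * sqrtC 3) ^+ 2 = - 3 :> algC.
  by rewrite exprMn sqrCi sqrtCK mulN1r.
have h2 : (2 : algC) != 0 by rewrite pnatr_eq0.
rewrite /rhoC; move: ('i * sqrtC 3) h => t h.
transitivity ((1 + 2 * t + t ^+ 2) / 4); first by field.
by rewrite h; field.
Qed.

Lemma eisC_is_zmod_morphism : zmod_morphism eisC.
Proof.
move=> [x y] [x' y']; rewrite /eisC /= !rmorphD /= !rmorphN /=.
by ring.
Qed.
HB.instance Definition _ :=
  GRing.isZmodMorphism.Build eisenstein algC eisC eisC_is_zmod_morphism.

Lemma eisC_is_monoid_morphism : monoid_morphism eisC.
Proof.
split; first by rewrite /eisC /= mul0r addr0.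
move=> [x y] [x' y']; rewrite /eisC /= !(rmorphD, rmorphN, rmorphM) /=.
set X := x%:~R; set Y := y%:~R; set X' := x'%:~R; set Y' := y'%:~R.
transitivity (X * X' + (X * Y' + Y * X') * rhoC + Y * Y' * rhoC ^+ 2);
  last by ring.
by rewrite rhoC2; ring.
Qed.
HB.instance Definition _ :=
  GRing.isMonoidMorphism.Build eisenstein algC eisC eisC_is_monoid_morphism.

Lemma eisC_inj : injective eisC.
Proof.
apply: raddf_inj => -[x y]; rewrite /eisC /= => h.
have h2 : (2 : algC) != 0 by rewrite pnatr_eq0.
have e : ((2 * x + y)%:~R : algC) + 'i * (y%:~R * sqrtC 3) = 0.
  rewrite intrD intrM -[2%:~R]/(2 : algC) -(mulr0 2) -h /eisC /rhoC /=.
  by move: x%:~R y%:~R 'i (sqrtC 3) => X Y I s; field.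
have s0 : (0 : algC) < sqrtC 3 by rewrite sqrtC_gt0 ltr0n.
have r2 : y%:~R * sqrtC 3 \is @Num.real algC.
  by rewrite rpredM ?realz // ger0_real // ltW.
have ei : y%:~R * sqrtC 3 = 0 :> algC.
  by rewrite -(@Im_rect _ (2 * x + y)%:~R _ _ r2) ?e ?raddf0 // realz.
have y0 : y = 0.
  by move/eqP: ei; rewrite mulf_eq0 (gt_eqF s0) orbF intr_eq0 => /eqP.
move: h; rewrite /eisC /= y0 mulr0z mul0r addr0 => /eqP; rewrite intr_eq0 => /eqP ->.
by [].
Qed.

Section EJ.

Variable alpha : eisenstein.

Definition pideal : {pred eisenstein} :=
  fun z => `[< exists w, z = w * alpha >].

Lemma pideal_zmod_closed : zmod_closed pideal.
Proof.
split=> [|x y /asboolP [v ->] /asboolP [w ->]]; apply/asboolP.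
  by exists 0; rewrite mul0r.
by exists (v - w); rewrite mulrBl.
Qed.
HB.instance Definition _ :=
  GRing.isZmodClosed.Build eisenstein pideal pideal_zmod_closed.

(* The library's ring structure on a quotient needs a proper ideal; when alpha
   is a unit the quotient is the zero ring, so it is given here as a possibly
   zero commutative ring. *)
Definition EJ := {ideal_quot pideal}.

HB.instance Definition _ := Choice.on EJ.
HB.instance Definition _ := GRing.Zmodule.on EJ.
HB.instance Definition _ : EqQuotient _ (Quotient.equiv pideal) EJ :=
  EqQuotient.on EJ.
HB.instance Definition _ : ZmodQuotient _ (Quotient.equiv pideal) 0 -%R +%R EJ
  := ZmodQuotient.on EJ.

Definition EJ_mul (u v : EJ) : EJ := \pi_EJ (repr u * repr v).

Lemma EJ_mulE (z w : eisenstein) :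
  EJ_mul (\pi_EJ z) (\pi_EJ w) = \pi_EJ (z * w).
Proof.
apply/eqP; rewrite /EJ_mul -Quotient.idealrBE.
have rE t : exists c, repr (\pi_EJ t) = t + c * alpha.
  have : repr (\pi_EJ t) - t \in pideal.
    by rewrite Quotient.idealrBE reprK.
  by case/asboolP=> c hc; exists c; rewrite -hc addrC subrK.
have [c ->] := rE z; have [d ->] := rE w.
by apply/asboolP; exists (z * d + c * w + c * d * alpha); ring.
Qed.

Lemma EJ_mulA : associative EJ_mul.
Proof.
move=> u v w; rewrite -[u]reprK -[v]reprK -[w]reprK.
by rewrite (EJ_mulE (repr v)) (EJ_mulE (repr u) (repr v)) !EJ_mulE mulrA.
Qed.
Lemma EJ_mulC : commutative EJ_mul.
Proof. by move=> u v; rewrite /EJ_mul mulrC. Qed.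
Lemma EJ_mul1 : left_id (\pi_EJ 1) EJ_mul.
Proof. by move=> u; rewrite -[u]reprK EJ_mulE mul1r. Qed.
Lemma EJ_mulDl : left_distributive EJ_mul +%R.
Proof.
move=> u v w; rewrite -[u]reprK -[v]reprK -[w]reprK.
rewrite -raddfD (EJ_mulE (repr u)) (EJ_mulE (repr v)) EJ_mulE -raddfD.
by rewrite mulrDl.
Qed.
HB.instance Definition _ :=
  GRing.Zmodule_isComPzRing.Build EJ EJ_mulA EJ_mulC EJ_mul1 EJ_mulDl.

Definition EJ_adj : rel EJ := fun u v =>
  u - v \in [seq \pi_EJ s | s <- [:: 1; -1; rho; - rho; rho ^+ 2; - rho ^+ 2]].

(* u :: p is the list of nodes visited, so the path has size p edges. *)
Definition EJ_path (u v : EJ) (p : seq EJ) : bool :=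
  [&& path EJ_adj u p, last u p == v & uniq (u :: p)].

Definition EJ_path_length (u v : EJ) (l : nat) : Prop :=
  exists2 p, EJ_path u v p & size p = l.

Lemma EJ_connected (u v : EJ) : exists l, `[< EJ_path_length u v l >].
Proof.
suff [p pp <-] : exists2 p, path EJ_adj u p & last u p = v.
  case/shortenP: pp => q qp quniq _.
  exists (size q); apply/asboolP; exists q => //.
  by rewrite /EJ_path qp quniq eqxx.
pose R x y := exists2 p, path EJ_adj x p & last x p = y.
have Rtr x y z : R x y -> R y z -> R x z.
  move=> [p pp <-] [q pq <-]; exists (p ++ q); last by rewrite last_cat.
  by rewrite cat_path pp.
have Rn s : s \in [:: 1; -1; rho; - rho] ->
    forall x n, R x (x + \pi_EJ (s *+ n)).
  move=> hs x; elim=> [|n IH]; first by exists [::]; rewrite //= raddf0 addr0.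
  apply: Rtr IH _; exists [:: x + \pi_EJ (s *+ n.+1)] => //=.
  rewrite andbT /EJ_adj opprD addrACA subrr add0r -raddfB mulrSr opprD.
  rewrite addrA subrr add0r; apply: map_f.
  by move: hs; rewrite !inE => /or4P[] /eqP ->; rewrite ?opprK eqxx ?orbT.
have Rz s : s \in [:: 1; rho] -> forall x (n : int), R x (x + \pi_EJ (s *~ n)).
  move=> hs x [] n; first by apply: Rn; move: hs; rewrite !inE => /orP[] ->; rewrite ?orbT.
  rewrite NegzE mulrNz -mulNrz; apply: Rn.
  by move: hs; rewrite !inE => /orP[] /eqP ->; rewrite eqxx ?orbT.
pose r := repr (v - u).
have hr : 1 *~ eis1 r + rho *~ eisrho r = r.
  by rewrite -[rho *~ _]mulrzl -EisE; case: (r).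
have hv : \pi_EJ (1 *~ eis1 r) + \pi_EJ (rho *~ eisrho r) = v - u.
  by rewrite -raddfD hr; exact: reprK.
have -> : v = u + \pi_EJ (1 *~ eis1 r) + \pi_EJ (rho *~ eisrho r).
  by rewrite -addrA hv addrC subrK.
by apply: Rtr (Rz _ _ _ _) (Rz _ _ _ _); rewrite !inE eqxx ?orbT.
Qed.

Definition EJ_dist (u v : EJ) : nat := ex_minn (EJ_connected u v).

End EJ.

(* Main.v *)
Require Import Defs.
From mathcomp Require Import all_boot all_order all_algebra.
From mathcomp Require Import generic_quotient ring_quotient boolp zify ring.
Set Implicit Arguments.
Unset Strict Implicit.
Unset Printing Implicit Defensive.
Import Order.TTheory GRing.Theory Num.Theory.

(** A path from u to v that misses a vertex can always be turned into a path
   from u to v with exactly one more vertex; starting from a shortest path this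
   produces every length up to n - 1.  The extension is local.  By connectivity
   there is a missed vertex z (a hole) adjacent to the path, and one looks at
   how the path runs through the triangular lattice near z.  If some edge of
   the path forms a triangle with z, insert z there.  Otherwise a few
   reroutings of the path around z (reversing the stretch between two of its
   edges, moving one vertex of the path together with z into another edge) are
   possible unless the path has a very specific shape near z; the remaining
   shapes yield to rerouting at another hole, possibly after exchanging z with
   a neighbouring vertex of the path.

   The case analysis is finite because only boundedly many lattice points near
   z matter.  It uses that lattice points whose difference has norm at most 9
   are distinct in the quotient, which holds when n > 9; the five networks with
   n <= 9 are small enough for exhaustive search. *)

(** * Rerouting paths in a graph *)

Section PathExtension.

Variables (T : eqType) (e : rel T).
Hypothesis esym : symmetric e.

(** The list holds both ends and fixes them through [ohead], so reversing it merely exchanges [u]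
    and [v]; every argument about successors then serves for predecessors. *)
Definition uvpath u v (s : seq T) :=
  [&& sorted e s, uniq s, ohead s == Some u & ohead (rev s) == Some v].

Definition extends u v (s : seq T) :=
  exists2 s' : seq T, uvpath u v s' & size s' = (size s).+1.

Definition next (s : seq T) x y := (x, y) \in zip s (behead s).

Lemma uvpath_rev u v s : uvpath u v s = uvpath v u (rev s).
Proof.
rewrite /uvpath rev_sorted rev_uniq revK (eq_sorted (e' := e)).
  by do 2![congr (_ && _)]; rewrite andbC.
by move=> x y; rewrite esym.
Qed.

Lemma extends_rev u v s : extends v u (rev s) -> extends u v s.
Proof.
case=> s' ps' ss'; exists (rev s'); first by rewrite -uvpath_rev.
by rewrite size_rev ss' size_rev.
Qed.

Lemma next_cons a s x y :
  next (a :: s) x y = (x == a) && (ohead s == Some y) || next s x y.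
Proof.
rewrite /next; case: s => [|b s]; rewrite /= ?in_nil ?andbF // inE.
by rewrite -[(x, y) == _]/((x == a) && (y == b)) -[Some b == _]/(b == y) [b == y]eq_sym.
Qed.

Lemma nextP s x y :
  reflect (exists A B, s = A ++ [:: x, y & B]) (next s x y).
Proof.
apply: (iffP idP) => [|[A [B ->]]]; last first.
  by elim: A => [|a A IH]; rewrite ?cat_cons next_cons ?IH ?orbT //= !eqxx.
elim: s => [|a s IH] //; rewrite next_cons => /orP[/andP[/eqP-> /eqP]|].
  by case: s {IH} => // b B [->]; exists [::], B.
by case/IH=> A [B ->]; exists (a :: A), B.
Qed.

Lemma next_rev s x y : next (rev s) y x = next s x y.
Proof.
suff h s' a b : next s' a b -> next (rev s') b a.
  by apply/idP/idP => /h; rewrite ?revK.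
case/nextP=> A [B ->]; apply/nextP; exists (rev B), (rev A).
by rewrite rev_cat !rev_cons -!cats1 -!catA.
Qed.

Lemma next_adj u v s x y : uvpath u v s -> next s x y -> e x y.
Proof.
case/and4P=> so _ _ _ /nextP[A [B eqs]].
by move: so; rewrite eqs sorted_cat_cons => /andP[_ /andP[]].
Qed.

Lemma next_index s x y : uniq s -> next s x y -> index y s = (index x s).+1.
Proof.
move=> us /nextP[A [B eqs]]; move: us; rewrite eqs cat_uniq => /and3P[_ h].
rewrite /= inE negb_or => /andP[/andP[xy _] _].
move: h; rewrite /= !negb_or => /and3P[xA yA _].
by rewrite !index_cat (negPf xA) (negPf yA) /= !eqxx (negPf xy) addn0 addn1.
Qed.

Lemma next_mem s x y : next s x y -> (x \in s) && (y \in s).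
Proof.
by case/nextP=> A [B ->]; rewrite !mem_cat !inE !eqxx ?orbT.
Qed.

Lemma next_injr s x y y' : uniq s -> next s x y -> next s x y' -> y = y'.
Proof.
move=> us n1 n2; have [/andP[_ m1] /andP[_ m2]] := (next_mem n1, next_mem n2).
by apply: (index_inj x m1 m2); rewrite (next_index us n1) (next_index us n2).
Qed.

Lemma next_injl s x x' y : uniq s -> next s x y -> next s x' y -> x = x'.
Proof.
by move=> us n1 n2; apply: (@next_injr (rev s) y); rewrite ?rev_uniq ?next_rev.
Qed.

Lemma next_head u v s x : uvpath u v s -> ~~ next s x u.
Proof.
case/and4P=> _ us /eqP hu _; apply/negP=> /(next_index us).
by case: s hu {us} => //= a s [->]; rewrite eqxx.
Qed.

Lemma next_last u v s x : uvpath u v s -> ~~ next s v x.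
Proof. by rewrite uvpath_rev -next_rev => /next_head. Qed.

Lemma uvpath_succ u v s x : uvpath u v s -> x \in s -> x = v \/ exists y, next s x y.
Proof.
case/and4P=> _ _ _ lv /splitPr xs; case: xs lv => A [|y B].
  by rewrite -[A ++ _]cat_rcons cats0 rev_rcons /= => /eqP[->]; left.
by move=> _; right; exists y; apply/nextP; exists A, B.
Qed.

Lemma uvpath_pred u v s x : uvpath u v s -> x \in s -> x = u \/ exists y, next s y x.
Proof.
rewrite uvpath_rev -mem_rev => p /(uvpath_succ p)[->|[y]]; first by left.
by rewrite next_rev => n; right; exists y.
Qed.

Lemma ohead_cat (A B C : seq T) x :
  ohead (A ++ x :: B) = ohead (A ++ x :: C) :> option T.
Proof. by case: A. Qed.

Lemma ohead_rev_cat (A B : seq T) x : ohead (rev (A ++ x :: B)) = Some (last x B).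
Proof. by rewrite rev_cat lastI rev_rcons. Qed.

Lemma ohead_cat2 (A B : seq T) :
  ohead (A ++ B) = if ohead A is Some x then Some x else ohead B.
Proof. by case: A. Qed.

(** A rearrangement of [z :: s] is automatically duplicate-free and one longer. Each rerouting below
    therefore only has to check its new edges and that the ends stay in place. *)
Lemma extend_by u v s z s' : uvpath u v s -> z \notin s ->
    sorted e s' -> perm_eq s' (z :: s) ->
    ohead s' = ohead s -> ohead (rev s') = ohead (rev s) ->
  extends u v s.
Proof.
move=> /and4P[_ us hu hv] zs so pe h1 h2; exists s'; last by rewrite (perm_size pe).
by rewrite /uvpath so (perm_uniq pe) /= zs us h1 h2 hu hv.
Qed.

Lemma extend_insert u v s x y z :
  uvpath u v s -> next s x y -> z \notin s -> e x z -> e z y -> extends u v s.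
Proof.
move=> p /nextP[A [B eqs]] zs xz zy.
have so : sorted e s by case/and4P: p.
rewrite eqs in so; move: so; rewrite sorted_cat_cons /= => /and3P[sA _ sB].
apply: (extend_by (s' := A ++ [:: x, z, y & B]) p zs).
- by rewrite sorted_cat_cons /= sA xz zy.
- by rewrite eqs; apply/permP=> a; rewrite /= !count_cat /=; clear; lia.
- by rewrite eqs; exact: ohead_cat.
- by rewrite eqs !ohead_rev_cat /= ?last_cat.
Qed.

(** Either edge may come first. The stretch [M] is described by its first and last vertex because
    these coincide when the two edges share a vertex. *)
Lemma next_split s x x' y y' : next s x x' -> next s y y' -> uniq s -> x <> y ->
  (exists A M B, [/\ s = A ++ x :: M ++ y' :: B,
     ohead M = Some x' & ohead (rev M) = Some y]) \/
  (exists A M B, [/\ s = A ++ y :: M ++ x' :: B,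
     ohead M = Some y' & ohead (rev M) = Some x]).
Proof.
move=> n1 n2 us /eqP xy.
wlog lt : x x' y y' n1 n2 xy / index x s < index y s => [W|].
  case: (ltngtP (index x s) (index y s)) => [lt|lt|eqi]; first exact: W.
    by case: (W _ _ _ _ n2 n1 _ lt); rewrite 1?eq_sym //; [right|left].
  have [/andP[mx _] /andP[my _]] := (next_mem n1, next_mem n2).
  by rewrite (index_inj x mx my eqi) eqxx in xy.
left; case/nextP: n2 => C [B eqs].
have yC : y \notin C.
  by move: us; rewrite eqs cat_uniq /= negb_or => /and3P[_ /andP[]].
have xC : x \in C.
  move: lt; rewrite eqs !index_cat (negPf yC) /= eqxx addn0.
  by case: ifP => // _; rewrite ltnNge leq_addr.
case/splitPr: xC eqs => A D eqs; exists A, (rcons D y), B; split.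
- by rewrite eqs -catA /= cat_rcons.
- move: n1 us; rewrite eqs -catA /= => /nextP[A' [B' eqs']] us.
  have hx : next (A ++ x :: D ++ [:: y, y' & B]) x (head y D).
    apply/nextP; exists A, (behead (rcons D y) ++ y' :: B).
    by case: (D) => [|d D'] //=; rewrite cat_rcons.
  have -> : x' = head y D.
    by apply: (next_injr us _ hx); apply/nextP; exists A', B'.
  by case: (D).
by rewrite rev_rcons.
Qed.

Lemma sorted_cat3 A x m M m' y B : ohead M = Some m -> ohead (rev M) = Some m' ->
  sorted e (A ++ x :: M ++ y :: B) =
  [&& sorted e (rcons A x), e x m, sorted e M, e m' y & sorted e (y :: B)].
Proof.
case: M => // m1 M [->] lM; have -> : m' = last m M.
  by move: lM; rewrite lastI rev_rcons => -[->].
by rewrite sorted_cat_cons /= cat_path.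
Qed.

Lemma sorted_rev A : sorted e (rev A) = sorted e A.
Proof. by rewrite rev_sorted; apply: eq_sorted => x y; rewrite esym. Qed.

(** With [x] before [y], the path runs [x], [x'] ... [y], [y']. Reversing the middle stretch and
    putting [z] in front of it gives [x], [z], [y] ... [x'], [y'], whose only new edges are the
    three assumed ones. *)
Lemma extend_rotate u v s x x' y y' z :
    uvpath u v s -> next s x x' -> next s y y' -> z \notin s -> x <> y ->
  e x z -> e y z -> e x' y' -> extends u v s.
Proof.
move=> p n1 n2 zs xy xz yz xy'.
have us : uniq s by case/and4P: p.
wlog [A [M [B [eqs hM lM]]]] : x x' y y' n1 n2 xy xz yz xy' / exists A M B,
    [/\ s = A ++ x :: M ++ y' :: B, ohead M = Some x' & ohead (rev M) = Some y].
  case: (next_split n1 n2 us xy) => h W; apply: W h => //; first exact: nesym.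
  by rewrite esym.
have so : sorted e s by case/and4P: p.
rewrite eqs (sorted_cat3 _ _ _ _ hM lM) in so; case/and5P: so => sA _ sM _ sB.
apply: (extend_by (s' := A ++ x :: z :: rev M ++ y' :: B) p zs).
- rewrite -(cat_rcons x) (@sorted_cat3 _ z y (rev M) x' y' B) ?revK // sorted_rev sM sB xy' /=.
  by rewrite -cats1 cat_rcons sorted_cat_cons sA /= xz esym yz.
- rewrite eqs; apply/permP=> a; rewrite /=.
  rewrite !(count_cat, count_rev) /= !(count_cat, count_rev) /=.
  by clear; lia.
- by rewrite eqs; exact: ohead_cat.
- by rewrite eqs !ohead_rev_cat /= ?last_cat.
Qed.

Lemma extend_rotate_rev u v s x x' y y' z :
    uvpath u v s -> next s x x' -> next s y y' -> z \notin s -> x' <> y' ->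
  e x' z -> e y' z -> e x y -> extends u v s.
Proof.
move=> p n1 n2 zs xy xz yz xy'; apply: extends_rev.
by apply: (@extend_rotate _ _ _ x' x y' y z); rewrite -?uvpath_rev ?next_rev ?mem_rev.
Qed.

Lemma next_rem A c B x y :
  x <> c -> y <> c -> next (A ++ c :: B) x y -> next (A ++ B) x y.
Proof.
move=> /eqP xc /eqP yc; elim: A => [|a A IH]; rewrite ?cat0s ?cat_cons !next_cons.
  by rewrite (negPf xc).
case/orP=> [/andP[-> h]|/IH ->]; last by rewrite orbT.
by case: A h {IH} => [|d A] /eqP[h]; [rewrite h eqxx in yc|rewrite /= h eqxx].
Qed.

Lemma next_subst A q z B x y :
  x <> q -> y <> q -> next (A ++ q :: B) x y -> next (A ++ z :: B) x y.
Proof.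
move=> /eqP xq /eqP yq; elim: A => [|a A IH]; rewrite ?cat0s ?cat_cons !next_cons.
  by rewrite (negPf xq) /= => ->; rewrite orbT.
case/orP=> [/andP[-> h]|/IH ->]; last by rewrite orbT.
by case: A h {IH} => [|d A] /eqP[h]; [rewrite h eqxx in yq|rewrite /= h eqxx].
Qed.

Lemma next_next s a c b : uniq s -> next s a c -> next s c b ->
  exists A B, s = A ++ [:: a, c, b & B].
Proof.
move=> us n1 /nextP[A [B eqs]]; case: (lastP A) eqs => [|A' d] eqs.
  by have := next_index us n1; rewrite eqs /= eqxx.
exists A', B; rewrite eqs cat_rcons; congr (_ ++ _ :: _).
by apply: next_injl us _ n1; rewrite eqs cat_rcons; apply/nextP; exists A', (b :: B).
Qed.

(* Bypass c by the edge a b, then insert both c and z between x and y. *)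
Lemma extend_move u v s a c b x y z :
    uvpath u v s -> next s a c -> next s c b -> e a b -> next s x y ->
    x <> c -> y <> c -> z \notin s -> e c z ->
  e x c && e y z || e y c && e x z -> extends u v s.
Proof.
move=> p n1 n2 ab nxy xc yc zs cz h.
have us : uniq s by case/and4P: p.
have [A [B eqs]] := next_next us n1 n2.
pose s0 := A ++ [:: a, b & B].
have us0 : uniq s0 /\ c \notin s0.
  move: us; rewrite eqs (perm_uniq (s2 := c :: s0)) ?cons_uniq; last first.
    by apply/permP=> d; rewrite /= !count_cat /=; clear; lia.
  by case/andP.
have p0 : uvpath u v s0.
  have /and4P[so _ hu hv] := p; apply/and4P; split; rewrite ?us0.1 //.
  - move: so; rewrite eqs !sorted_cat_cons /= => /and4P[-> _ _ ->].
    by rewrite ab.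
  - by rewrite -(eqP hu) eqs; apply/eqP/ohead_cat.
  by rewrite -(eqP hv) eqs; apply/eqP; rewrite !ohead_rev_cat.
have n0 : next s0 x y.
  have -> : s0 = (rcons A a) ++ (b :: B) by rewrite cat_rcons.
  by apply: (next_rem (c := c)) => //; rewrite cat_rcons -eqs.
have sub0 d : d \in s0 -> d \in s.
  by rewrite eqs !mem_cat !inE => /orP[->|/or3P[]->]; rewrite ?orbT.
have zs0 : z \notin s0 by apply: contra zs => /sub0.
(* The pair [w], [w'] is [c], [z] in one order or the other, according to which of them is adjacent
   to [x]. *)
have eadd w w' : e x w -> e w w' -> e w' y -> perm_eq [:: w; w'] [:: z; c] -> extends u v s.
  move=> xw ww' wy pe; case/nextP: n0 => C [D eqs0].
  have so : sorted e s0 by case/and4P: p0.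
  rewrite eqs0 in so; move: so; rewrite sorted_cat_cons /= => /and3P[sC _ sD].
  apply: (extend_by (s' := C ++ [:: x, w, w', y & D]) p zs).
  - by rewrite sorted_cat_cons /= sC xw ww' wy.
  - have : perm_eq s (c :: s0).
      by rewrite eqs; apply/permP=> d; rewrite /= !count_cat /=; clear; lia.
    move/permP=> h1; apply/permP=> d; move: (h1 d) (permP pe d).
    by rewrite eqs0 /= !count_cat /=; clear; lia.
  - have -> : ohead s = ohead s0 by rewrite eqs; exact: ohead_cat.
    by rewrite eqs0; exact: ohead_cat.
  - have -> : ohead (rev s) = ohead (rev s0).
      by case/and4P: p => _ _ _ /eqP->; case/and4P: p0 => _ _ _ /eqP->.
    by rewrite eqs0 !ohead_rev_cat.
case/orP: h => /andP[h1 h2].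
  by apply: (eadd c z h1 cz); [rewrite esym|rewrite (perm_catC [:: c] [:: z])].
by apply: (eadd z c h2); rewrite 1?esym // perm_refl.
Qed.

(* Cut behind x, y and w, and reverse the two middle stretches, with z between
   x and y.  The conditions are symmetric in x and y because it is not known
   which of them comes first. *)
Lemma extend_end u v s x x' y y' w z :
    uvpath u v s -> next s x x' -> next s y y' -> next s w v ->
    z \notin s -> x <> y -> x <> w -> y <> w -> e x z -> e y z ->
  e x' w -> e x' v -> e y' w -> e y' v -> extends u v s.
Proof.
move=> p n1 n2 n3 zs xy xw yw xz yz xw' xv' yw' yv'.
have us : uniq s by case/and4P: p.
wlog [A [M [B [eqs hM lM]]]] : x x' y y' n1 n2 xy xw yw xz yz xw' xv' yw' yv' / exists A M B,
    [/\ s = A ++ x :: M ++ y' :: B, ohead M = Some x' & ohead (rev M) = Some y].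
  by case: (next_split n1 n2 us xy) => h W; apply: W h => //; exact: nesym.
have /and4P[so _ _ /eqP lv] := p.
have lB : last y' B = v by move: lv; rewrite eqs -cat_cons catA ohead_rev_cat => -[].
(* An empty [B] would mean [y' = v], so that [y] and [w] would both precede [v]. *)
case/lastP: B eqs lB => [|B v'] eqs; rewrite /= ?last_rcons => lB.
  by case: yw; apply: (next_injl us n2); rewrite lB.
rewrite {v'}lB in eqs.
case: M hM lM eqs => // m M [->] lM eqs {m}.
have [N eN] : exists N, y' :: B = rcons N w.
  exists (belast y' B); rewrite lastI; congr rcons.
  apply: (next_injl us _ n3); rewrite eqs; apply/nextP.
  exists (A ++ x :: x' :: M ++ belast y' B), [::].
  have -> : y' :: rcons B v = belast y' B ++ [:: last y' B; v].
    by rewrite -rcons_cons lastI -!cats1 -catA.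
  by rewrite -[RHS]catA /= -[in RHS]catA.
rewrite -rcons_cons eN -[rcons (rcons _ _) _]cats1 -cats1 -!catA /= in eqs.
have hN : ohead (rcons N w) = Some y' by rewrite -eN.
have eNv : N ++ [:: w; v] = y' :: rcons B v.
  by rewrite -rcons_cons eN -!cats1 -catA.
have : sorted e (A ++ x :: (x' :: M) ++ y' :: rcons B v).
  by rewrite -eNv; rewrite eqs in so.
rewrite (@sorted_cat3 _ _ x' _ y) // => /and5P[sA _ sM _ sN].
have sN2 : sorted e (rcons N w).
  by rewrite -eN; move: sN; rewrite /= rcons_path => /andP[].
apply: (extend_by (s' := rcons A x ++ z :: (rev (x' :: M) ++ rev (rcons N w)) ++ [:: v]) p zs).
- have sNM : sorted e (rcons N w ++ x' :: M).
    by rewrite cat_rcons sorted_cat_cons sN2 /= esym xw'.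
  rewrite (@sorted_cat3 _ _ y _ y') ?ohead_cat2 //.
  + rewrite -rev_cat sorted_rev sNM yv' /= andbT [e z y]esym yz andbT.
    by rewrite -cats1 cat_rcons sorted_cat_cons sA /= xz.
  + by rewrite lM.
  by rewrite rev_cat revK -eN.
- rewrite eqs; apply/permP=> a; rewrite !cat_rcons /= -!cats1.
  rewrite -cat1s -[x :: x' :: _]/([:: x; x'] ++ _) -[z :: (_ ++ _) ++ _]cat1s.
  rewrite -[x' :: M]cat1s !(count_cat, count_rev) /= ?(count_cat, count_rev) /=.
  rewrite ?addn0.
  by clear; lia.
- by rewrite eqs cat_rcons; exact: ohead_cat.
- by rewrite lv -cat_cons catA ohead_rev_cat.
Qed.

(** Since [q] is interior, replacing it by [z] keeps the ends and the length, so an extension of the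
    new path is as good as one of [s]. The new hole is [q]; the last two clauses carry over what was
    known about other vertices. *)
Lemma uvpath_swap u v s a q b z : uvpath u v s -> next s a q -> next s q b ->
    z \notin s -> e a z -> e z b ->
  exists s', [/\ uvpath u v s', size s' = size s, next s' a z, next s' z b &
    [/\ q \notin s', forall x, x <> q -> x <> z -> (x \in s') = (x \in s) &
      forall x y, x <> q -> y <> q -> next s x y -> next s' x y]].
Proof.
move=> p n1 n2 zs az zb; have us : uniq s by case/and4P: p.
have [A [B eqs]] := next_next us n1 n2; exists (A ++ [:: a, z, b & B]).
have pe : perm_eq (q :: A ++ [:: a, z, b & B]) (z :: s).
  by rewrite eqs; apply/permP=> c; rewrite /= !count_cat /=; clear; lia.
have : uniq (z :: s) by rewrite /= zs.
rewrite -(perm_uniq pe) => /= /andP[qs us'].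
have /and4P[so _ hu hv] := p.
split=> //.
- rewrite /uvpath us' -(eqP hu) -(eqP hv) eqs !ohead_rev_cat eqxx andbT.
  rewrite eqs in so; move: so; rewrite !sorted_cat_cons /= => /and4P[-> _ _ ->].
  by rewrite az zb; apply/eqP/ohead_cat.
- by rewrite eqs !size_cat.
- by apply/nextP; exists A, (b :: B).
- by apply/nextP; exists (rcons A a), B; rewrite cat_rcons.
split=> // [x /eqP xq /eqP xz|x y xq yq nxy].
  by move: (perm_mem pe x); rewrite !inE (negPf xq) (negPf xz).
by move: nxy; rewrite eqs -!(cat_rcons a); exact: next_subst.
Qed.

End PathExtension.

(** * Checking local configurations *)

Local Open Scope ring_scope.
Local Open Scope quotient_scope.

Definition pt := (int * int)%type.
Definition padd (p q : pt) : pt := (p.1 + q.1, p.2 + q.2).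
Definition psub (p q : pt) : pt := (p.1 - q.1, p.2 - q.2).
(** The squared absolute value of [x + y * rho]. *)
Definition pnorm (p : pt) : int := p.1 * p.1 + p.1 * p.2 + p.2 * p.2.
Definition units : seq pt := [:: (1, 0); (0, 1); (-1, 1); (-1, 0); (0, -1); (1, -1)].
Definition adj (p q : pt) : bool := pnorm (psub q p) == 1.
(* Lattice points further apart may coincide in the network, so they are never
   assumed to be distinct. *)
Definition sep (p q : pt) : bool := 0 < pnorm (psub p q) <= 9.

(* Facts about a path, relative to a map from lattice points to the network:
   Out and In say whether a point is on the path, Next p q that q comes right
   after p, First and Last that a point is an end of the path. *)
Inductive fact := Out of pt | In of pt | Next of pt & pt
  | First of pt | Last of pt | NotFirst of pt | NotLast of pt.

Definition state := seq fact.

Definition outs (st : state) :=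
  pmap (fun f => if f is Out p then Some p else None) st.
Definition nexts (st : state) :=
  pmap (fun f => if f is Next p q then Some (p, q) else None) st.
Definition firsts (st : state) :=
  pmap (fun f => if f is First p then Some p else None) st.
Definition lasts (st : state) :=
  pmap (fun f => if f is Last p then Some p else None) st.

Definition has_in (st : state) (p : pt) :=
  has (fun f => match f with
    | In q | First q | Last q => p == q
    | Next q r => (p == q) || (p == r)
    | _ => false end) st.

Definition not_first (st : state) (p : pt) :=
  has (fun f => match f with
    | Out q | Last q | NotFirst q => p == q
    | Next _ q => p == q
    | First q => sep p q
    | _ => false end) st.

Definition not_last (st : state) (p : pt) :=
  has (fun f => match f with
    | Out q | First q | NotLast q => p == q
    | Next q _ => p == q
    | Last q => sep p q
    | _ => false end) st.

Definition derives (st : state) (f : fact) : bool :=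
  match f with
  | Out p => p \in outs st
  | In p => has_in st p
  | Next p q => (p, q) \in nexts st
  | First p => p \in firsts st
  | Last p => p \in lasts st
  | NotFirst p => not_first st p
  | NotLast p => not_last st p
  end.

Fixpoint reach (es : seq (pt * pt)) (k : nat) (p q : pt) : bool :=
  if p == q then true else
  if k is k'.+1 then has (fun e => if e.1 == p then reach es k' e.2 q else false) es
  else false.

Definition contradictory (st : state) : bool :=
  let es := nexts st in
  [|| has (has_in st) (outs st),
      has (not_first st) (firsts st),
      has (not_last st) (lasts st),
      has (fun e => has (fun e' => (e.1 == e'.1) && sep e.2 e'.2
                                || (e.2 == e'.2) && sep e.1 e'.1) es) es
    | has (fun e => reach es (size es) e.2 e.1) es].

(* Each disjunct is one of the reroutings extend_insert, extend_rotate,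
   extend_rotate_rev, extend_move and extend_end.  The nested conditions are
   written with "if" because && evaluates both sides under vm_compute. *)
Definition extendable_at (st : state) (z : pt) : bool :=
  let es := nexts st in
  let es1 := [seq e <- es | adj e.1 z] in
  let es2 := [seq e <- es | adj e.2 z] in
  [|| has (fun e => adj e.2 z) es1,
      has (fun e => has (fun e' => adj e.2 e'.2 && sep e.1 e'.1) es1) es1,
      has (fun e => has (fun e' => adj e.1 e'.1 && sep e.2 e'.2) es2) es2,
      has (fun e => has (fun e' => if (e'.1 == e.2) && adj e.1 e'.2 then
            has (fun g => [&& sep g.1 e.2, sep g.2 e.2
              & adj g.1 e.2 && adj g.2 z || adj g.2 e.2 && adj g.1 z]) es
          else false) es) es2
    | has (fun g => if g.2 \in lasts st then
          let es3 := [seq e <- es1 | [&& adj e.2 g.1, adj e.2 g.2 & sep e.1 g.1]] in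
          has (fun e => has (fun e' => sep e.1 e'.1) es3) es3
        else false) es].

Definition closed (st : state) : bool :=
  contradictory st || has (extendable_at st) (outs st).

(* Whether a fact surely survives when z replaces q on the path. *)
Definition swapped (q z : pt) (f : fact) : bool :=
  match f with
  | Out p => sep p z
  | In p => sep p q
  | Next p p' => sep p q && sep p' q
  | _ => true
  end.

(* A symmetry of the lattice, composed with path reversal if sym_rev. *)
Record symmetry := Sym {
  sym_rot : nat; sym_flip : bool; sym_rev : bool; sym_shift : pt }.

(** Multiplication by [rho], a turn by 60 degrees. *)
Definition rotate (p : pt) : pt := (- p.2, p.1 + p.2).
Definition transform (t : symmetry) (p : pt) : pt :=
  padd (iter (sym_rot t) rotate (if sym_flip t then (p.2, p.1) else p)) (sym_shift t).
Definition transform_fact (t : symmetry) (f : fact) : fact :=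
  match f with
  | Out p => Out (transform t p)
  | In p => In (transform t p)
  | Next p q => if sym_rev t then Next (transform t q) (transform t p)
    else Next (transform t p) (transform t q)
  | First p => if sym_rev t then Last (transform t p) else First (transform t p)
  | Last p => if sym_rev t then First (transform t p) else Last (transform t p)
  | NotFirst p =>
    if sym_rev t then NotLast (transform t p) else NotFirst (transform t p)
  | NotLast p =>
    if sym_rev t then NotFirst (transform t p) else NotLast (transform t p)
  end.

(* Case distinctions (the neighbour after p, the neighbour before p, whether p is
   on the path, whether p is the first or the last vertex), replacing q by the
   hole z between a and b, and reference to an image of an earlier state. *)
Inductive step :=
  | Succ of pt | Pred of pt | Member of pt | IsFirst of pt | IsLast of pt
  | Swap of pt & pt & pt & pt | Cite of nat & symmetry.

Section Run.

Variable known : seq state.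

Definition subgoals (i : step) (st : state) : option (seq state) :=
  match i with
  | Succ p => if has_in st p then
      Some ((Last p :: st) :: [seq Next p (padd p d) :: st | d <- units]) else None
  | Pred p => if has_in st p then
      Some ((First p :: st) :: [seq Next (padd p d) p :: st | d <- units]) else None
  | Member p => Some [:: Out p :: st; In p :: st]
  | IsFirst p => Some [:: First p :: st; NotFirst p :: st]
  | IsLast p => Some [:: Last p :: st; NotLast p :: st]
  | Swap a q b z =>
    if [&& (a, q) \in nexts st, (q, b) \in nexts st, z \in outs st,
           adj a z & adj z b]
    then Some [:: [:: Out q, Next a z, Next z b
                    & [seq f <- st | swapped q z f]]]
    else None
  | Cite k t =>
    if (k < size known)%N &&
       all (derives st) (map (transform_fact t) (nth [::] known k))
    then Some [::] else None
  end.

Fixpoint drop_closed (goals : seq state) : seq state :=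
  if goals is st :: goals' then if closed st then drop_closed goals' else goals else [::].

(* The goals form a stack: every step acts on the first one that is not closed,
   so a proof tree is given by the list of its steps in prefix order. *)
Fixpoint run (prog : seq step) (goals : seq state) : bool :=
  match drop_closed goals, prog with
  | [::], _ => true
  | _, [::] => false
  | st :: goals', i :: prog' =>
    if subgoals i st is Some new then run prog' (new ++ goals') else false
  end.

End Run.

(** * Soundness of the checker *)

Section Soundness.

Variables (T : eqType) (e : rel T).
Hypothesis esym : symmetric e.

(** Locally the graph looks like the triangular lattice: all edges at [f p] come from lattice edges
    at [p], and [f] is injective at short range. Globally [f] may identify points. *)
Record lattice_map (f : pt -> T) : Prop := LatticeMap {
  lattice_adj : forall p q, adj p q -> e (f p) (f q);
  lattice_nbr : forall p y, e (f p) y -> exists2 d, d \in units & y = f (padd p d);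
  lattice_sep : forall p q, sep p q -> f p <> f q }.

Definition holds u v (s : seq T) (f : pt -> T) (phi : fact) : Prop :=
  match phi with
  | Out p => f p \notin s
  | In p => f p \in s
  | Next p q => next s (f p) (f q)
  | First p => f p = u
  | Last p => f p = v
  | NotFirst p => f p <> u
  | NotLast p => f p <> v
  end.

(** An iterated conjunction instead of a statement about membership, since no decidable equality is
    declared on [fact]. *)
Definition sat u v s f (st : state) := foldr (fun phi P => holds u v s f phi /\ P) True st.

(** Quantifying over the path, its ends and the lattice map makes a valid state available again for
    a symmetric image, for the reversed path and after a swap. *)
Definition valid (st : state) := forall u v s f,
  u <> v -> lattice_map f -> uvpath e u v s -> sat u v s f st -> extends e u v s.

Lemma sat_has u v s f st a : sat u v s f st -> has a st ->
  exists2 phi, holds u v s f phi & a phi.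
Proof.
elim: st => //= phi st IH [h hst] /orP[|/IH]; first by exists phi.
exact.
Qed.

Lemma sat_outs u v s f st p : sat u v s f st -> p \in outs st -> f p \notin s.
Proof.
by elim: st => //= -[q|q|q r|q|q|q|q] st IH [h hst] /=; rewrite ?inE;
  try exact: IH; case/orP=> [/eqP->|]; [exact: h|exact: IH].
Qed.

Lemma sat_nexts u v s f st p : sat u v s f st -> p \in nexts st -> next s (f p.1) (f p.2).
Proof.
by elim: st => //= -[q|q|q r|q|q|q|q] st IH [h hst] /=; rewrite ?inE;
  try exact: IH; case/orP=> [/eqP->|]; [exact: h|exact: IH].
Qed.

Lemma sat_firsts u v s f st p : sat u v s f st -> p \in firsts st -> f p = u.
Proof.
by elim: st => //= -[q|q|q r|q|q|q|q] st IH [h hst] /=; rewrite ?inE;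
  try exact: IH; case/orP=> [/eqP->|]; [exact: h|exact: IH].
Qed.

Lemma sat_lasts u v s f st p : sat u v s f st -> p \in lasts st -> f p = v.
Proof.
by elim: st => //= -[q|q|q r|q|q|q|q] st IH [h hst] /=; rewrite ?inE;
  try exact: IH; case/orP=> [/eqP->|]; [exact: h|exact: IH].
Qed.

Section State.

Variables (u v : T) (s : seq T) (f : pt -> T) (st : state).
Hypotheses (uv : u <> v) (lf : lattice_map f) (path_s : uvpath e u v s).
Hypothesis sat_st : sat u v s f st.

Let uniq_s : uniq s. Proof. by case/and4P: path_s. Qed.

Lemma first_in : u \in s.
Proof. by case/and4P: path_s => _ _ /eqP; case: (s) => //= x s' [->]; rewrite mem_head. Qed.

Lemma last_in : v \in s.
Proof.
case/and4P: path_s => _ _ _ /eqP; rewrite -mem_rev.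
by case: (rev s) => //= x s' [->]; rewrite mem_head.
Qed.

Lemma has_inP p : has_in st p -> f p \in s.
Proof.
case/(sat_has sat_st) => -[q|q|q r|q|q|q|q] //= h.
- by move/eqP->.
- by case/andP: (next_mem h) => hq hr /orP[] /eqP->.
- by move/eqP->; rewrite h first_in.
- by move/eqP->; rewrite h last_in.
Qed.

Lemma not_firstP p : not_first st p -> f p <> u.
Proof.
case/(sat_has sat_st) => -[q|q|q r|q|q|q|q] //= h.
- by move/eqP-> => eu; rewrite eu first_in in h.
- by move/eqP-> => eu; move: (next_head (f q) path_s); rewrite -eu h.
- by move/(lattice_sep lf); rewrite h.
- by move/eqP->; rewrite h; exact: nesym.
- by move/eqP->.
Qed.

Lemma not_lastP p : not_last st p -> f p <> v.
Proof.
case/(sat_has sat_st) => -[q|q|q r|q|q|q|q] //= h.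
- by move/eqP-> => ev; rewrite ev last_in in h.
- by move/eqP-> => ev; move: (next_last esym (f r) path_s); rewrite -ev h.
- by move/eqP->; rewrite h.
- by move/(lattice_sep lf); rewrite h.
- by move/eqP->.
Qed.

Lemma derivesP phi : derives st phi -> holds u v s f phi.
Proof.
case: phi => [p|p|p q|p|p|p|p] /=.
- exact: (sat_outs sat_st).
- exact: has_inP.
- exact: (sat_nexts sat_st).
- exact: (sat_firsts sat_st).
- exact: (sat_lasts sat_st).
- exact: not_firstP.
- exact: not_lastP.
Qed.

(** Positions on the path grow along every [Next] fact. A chain of such facts leading back to its
    start is therefore impossible. *)
Lemma reachP k p q : reach (nexts st) k p q -> (index (f p) s <= index (f q) s)%N.
Proof.
elim: k p => [|k IH] p /=; first by case: eqP => // ->.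
case: eqP => [-> //|_] /hasP[[x y] xy] /=; case: eqP => // <- /IH.
by rewrite (next_index uniq_s (sat_nexts sat_st xy)); apply: ltnW.
Qed.

Lemma contradictoryP : ~~ contradictory st.
Proof.
apply/negP; case/or4P=> [/hasP[p /(sat_outs sat_st) h /has_inP]
  |/hasP[p /(sat_firsts sat_st) h /not_firstP//]
  |/hasP[p /(sat_lasts sat_st) h /not_lastP//]|].
  by rewrite (negPf h).
case/orP=> [/hasP[p /(sat_nexts sat_st) hp /hasP[q /(sat_nexts sat_st) hq]]|].
  case/orP=> /andP[/eqP eq /(lattice_sep lf)]; rewrite eq in hp; case.
    exact: next_injr hp hq.
  exact: next_injl hp hq.
case/hasP=> p /(sat_nexts sat_st) /(next_index uniq_s) h /reachP.
by rewrite h ltnn.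
Qed.

Lemma extendable_atP z : z \in outs st -> extendable_at st z -> extends e u v s.
Proof.
move=> /(sat_outs sat_st) zs; have ea := lattice_adj lf.
have nx := sat_nexts sat_st.
case/or4P; [| | |case/orP].
- case/hasP=> g; rewrite mem_filter => /andP[a1 /nx n] a2.
  apply: (extend_insert path_s n zs); first exact: ea.
  by rewrite esym; exact: ea.
- case/hasP=> g; rewrite mem_filter => /andP[a1 /nx n1] /hasP[h].
  rewrite mem_filter => /andP[a2 /nx n2] /andP[/ea a3 /(lattice_sep lf) gh].
  by apply: (extend_rotate esym path_s n1 n2 zs gh _ _ a3); exact: ea.
- case/hasP=> g; rewrite mem_filter => /andP[a1 /nx n1] /hasP[h].
  rewrite mem_filter => /andP[a2 /nx n2] /andP[/ea a3 /(lattice_sep lf) gh].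
  by apply: (extend_rotate_rev esym path_s n1 n2 zs gh _ _ a3); exact: ea.
- case/hasP=> g; rewrite mem_filter => /andP[/ea a1 /nx n1] /hasP[h /nx n2].
  case: andP => // -[/eqP eq /ea a2] /hasP[k /nx n3].
  case/and3P=> /(lattice_sep lf) k1 /(lattice_sep lf) k2 h4; rewrite eq in n2.
  apply: (extend_move esym path_s n1 n2 a2 n3 k1 k2 zs a1).
  by case/orP: h4 => /andP[/ea -> /ea ->]; rewrite ?orbT.
case/hasP=> g /nx n3; case: ifP => // /(sat_lasts sat_st) lg /hasP[h].
rewrite !mem_filter => /andP[/and3P[/ea b1 /ea b2 /(lattice_sep lf) b3] /andP[/ea b4 /nx n1]].
case/hasP=> k; rewrite !mem_filter => /andP[/and3P[/ea c1 /ea c2 /(lattice_sep lf) c3]].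
case/andP=> /ea c4 /nx n2 /(lattice_sep lf) hk.
rewrite lg in n3 b2 c2.
exact: (extend_end esym path_s n1 n2 n3 zs hk b3 c3).
Qed.

Lemma closedP : closed st -> extends e u v s.
Proof.
by rewrite /closed (negPf contradictoryP) => /hasP[z]; exact: extendable_atP.
Qed.

End State.

Lemma lattice_map_comp f g :
    (forall p q, pnorm (psub (g p) (g q)) = pnorm (psub p q)) ->
    (forall p d, d \in units ->
       exists2 d', d' \in units & padd (g p) d = g (padd p d')) ->
  lattice_map f -> lattice_map (f \o g).
Proof.
move=> hN hU [ha hn hs]; split=> [p q|p y /hn[d /(hU p)[d' d'u e1] ->]|p q].
- by rewrite /adj -hN; exact: ha.
- by exists d'; rewrite //= e1.
- by rewrite /sep -hN; exact: hs.
Qed.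

Lemma lattice_map_ext f f' : f =1 f' -> lattice_map f -> lattice_map f'.
Proof.
move=> E [ha hn hs]; split=> [p q|p y|p q]; rewrite -!E; [exact: ha| |exact: hs].
by move=> /hn[d du ->]; exists d; rewrite // E.
Qed.

Lemma lattice_map_iter f g k :
    (forall f, lattice_map f -> lattice_map (f \o g)) ->
  lattice_map f -> lattice_map (f \o iter k g).
Proof.
move=> hg lf; elim: k => [|k IH]; first exact: lattice_map_ext lf.
by apply: lattice_map_ext (hg _ IH) => p /=; rewrite -iterS iterSr.
Qed.

Lemma lattice_map_rotate f : lattice_map f -> lattice_map (f \o rotate).
Proof.
apply: lattice_map_comp => [[x y] [x' y']|[x y] d].
  by rewrite /pnorm /=; ring.
(* The witness is [d] turned back by 60 degrees. *)
rewrite !inE => h; exists (d.1 + d.2, - d.1).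
  by case/orP: h => [/eqP->|/orP[/eqP->|/orP[/eqP->|/orP[/eqP->|/orP[/eqP->|/eqP->]]]]].
by case: d {h} => d1 d2; rewrite /padd /rotate /=; congr pair; ring.
Qed.

Lemma lattice_map_transform f t : lattice_map f -> lattice_map (f \o transform t).
Proof.
case: t => k b r w lf.
(* A symmetry flips, then rotates, then shifts; precomposition meets these maps in the opposite
   order. *)
have {}lf : lattice_map (f \o padd^~ w).
  apply: lattice_map_comp lf => [[x y] [x' y']|[x y] d du].
    by rewrite /pnorm /=; ring.
  by exists d => //; rewrite /padd /=; congr pair; ring.
have {}lf := lattice_map_iter k lattice_map_rotate lf.
case: b; last exact: lf.
have {}lf : lattice_map (f \o padd^~ w \o iter k rotate \o fun p => (p.2, p.1)).
  apply: lattice_map_comp lf => [[x y] [x' y']|[x y] d].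
    by rewrite /pnorm /=; ring.
  rewrite !inE => h; exists (d.2, d.1) => //.
  by case/orP: h => [/eqP->|/orP[/eqP->|/orP[/eqP->|/orP[/eqP->|/orP[/eqP->|/eqP->]]]]].
exact: lf.
Qed.

Definition all_valid (l : seq state) := foldr (fun st P => valid st /\ P) True l.

Lemma all_valid_cat l l' : all_valid (l ++ l') -> all_valid l /\ all_valid l'.
Proof. by elim: l => //= st l IH [h /IH[]]. Qed.

Lemma all_valid_map (I : eqType) (F : I -> state) l i :
  all_valid (map F l) -> i \in l -> valid (F i).
Proof. by elim: l => //= j l IH [h /IH {}IH]; rewrite inE => /orP[/eqP->|/IH]. Qed.

Lemma all_valid_nth l k : all_valid l -> (k < size l)%N -> valid (nth [::] l k).
Proof. by elim: l k => [|st l IH] [|k] //= [h /IH] => [_ _|h'] //; exact: h'. Qed.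

Section Rules.

Variable known : seq state.
Hypothesis valid_known : all_valid known.

Lemma subgoalsP i st new : subgoals known i st = Some new -> all_valid new -> valid st.
Proof.
case: i => [p|p|p|p|p|a q b z|k t] /=.
- case: ifP => // hin [<-] [hl hnx] u v s f uv lf ps h.
  have [eqv|[y n]] := uvpath_succ ps (has_inP ps h hin).
    by apply: (hl _ _ _ _ uv lf ps).
  have [d du eqy] := lattice_nbr lf (next_adj ps n).
  have hd := @all_valid_map _ (fun d => Next p (padd p d) :: st) units d hnx du.
  by apply: (hd _ _ _ _ uv lf ps); rewrite /= -eqy.
- case: ifP => // hin [<-] [hl hnx] u v s f uv lf ps h.
  have [eqv|[y n]] := uvpath_pred esym ps (has_inP ps h hin).
    by apply: (hl _ _ _ _ uv lf ps).
  have eyx : e (f p) y by rewrite esym; exact: next_adj ps n.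
  have [d du eqy] := lattice_nbr lf eyx.
  have hd := @all_valid_map _ (fun d => Next (padd p d) p :: st) units d hnx du.
  by apply: (hd _ _ _ _ uv lf ps); rewrite /= -eqy.
- move=> [<-] [h1 [h2 _]] u v s f uv lf ps h.
  have [hin|hin] := boolP (f p \in s).
    exact: (h2 _ _ _ _ uv lf ps).
  exact: (h1 _ _ _ _ uv lf ps).
- move=> [<-] [h1 [h2 _]] u v s f uv lf ps h.
  have [hin|/eqP hin] := eqVneq (f p) u.
    exact: (h1 _ _ _ _ uv lf ps).
  exact: (h2 _ _ _ _ uv lf ps).
- move=> [<-] [h1 [h2 _]] u v s f uv lf ps h.
  have [hin|/eqP hin] := eqVneq (f p) v.
    exact: (h1 _ _ _ _ uv lf ps).
  exact: (h2 _ _ _ _ uv lf ps).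
- case: ifP => // /and4P[aq qb zo /andP[az zb]] [<-] [h1 _] u v s f uv lf ps h.
  (* The subgoal is applied to the path after the swap, which has the same ends and size; what
     remains is that the retained facts hold for it. *)
  have zs := sat_outs h zo.
  have [s' [ps' ss' n1 n2 [qs' hmem hnext]]] :=
    uvpath_swap ps (sat_nexts h aq) (sat_nexts h qb) zs
      (lattice_adj lf az) (lattice_adj lf zb).
  have [] := h1 u v s' f uv lf ps'; last by move=> s2; rewrite ss' => p2 e2; exists s2.
  split=> //; split=> //; split=> //.
  elim: st h {aq qb zo h1} => //= phi st IH [hphi /IH {}IH]; case: ifP => //= sw.
  split=> //; case: phi hphi sw => [p|p|p p'|p|p|p|p] //=.
  + move=> hp /(lattice_sep lf) pz; have [->//|/eqP pq] := eqVneq (f p) (f q).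
    by rewrite hmem.
  + move=> hp /(lattice_sep lf) pq; rewrite hmem // => pz.
    by rewrite -pz hp in zs.
  + by move=> hp /andP[/(lattice_sep lf) ? /(lattice_sep lf) ?]; exact: hnext.
case: ifP => // /andP[hk hd] [<-] _ u v s f uv lf ps h.
have hv := all_valid_nth valid_known hk; move: (nth _ _ _) hv hd => st' hv hd.
(* The cited state is used with the lattice map precomposed with the symmetry and, if [sym_rev t],
   with the reversed path and exchanged ends. *)
have lf' := lattice_map_transform t lf.
have hd' : forall phi, derives st phi -> holds u v s f phi by move=> phi; exact: derivesP.
case rv: (sym_rev t).
  apply: (extends_rev esym); apply: (hv _ _ _ _ (nesym uv) lf'); first by rewrite -uvpath_rev.
  elim: st' hd {hv} => //= phi st' IH /andP[/hd' hp /IH]; split=> //.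
  by case: phi hp => [p|p|p q|p|p|p|p] /=; rewrite ?rv /= ?mem_rev ?next_rev.
apply: (hv _ _ _ _ uv lf' ps).
elim: st' hd {hv} => //= phi st' IH /andP[/hd' hp /IH]; split=> //.
by case: phi hp => [p|p|p q|p|p|p|p] /=; rewrite ?rv.
Qed.

Lemma drop_closedP goals : all_valid (drop_closed goals) -> all_valid goals.
Proof.
elim: goals => //= st goals IH; case: ifP => // hc /IH; split=> //.
by move=> u v s f uv lf ps h; exact: (closedP uv lf ps h hc).
Qed.

Lemma runP prog goals : run known prog goals -> all_valid goals.
Proof.
elim: prog goals => [|i prog IH] goals /= h; apply: drop_closedP; move: h.
  by case: (drop_closed _).
case: (drop_closed _) => // st goals'.
case E: subgoals => [new|] // /IH /all_valid_cat[/(subgoalsP E)]; split=> //.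
Qed.

End Rules.
End Soundness.

(** * The case analysis around a hole *)

Local Open Scope int_scope.

(* In all states the hole is (0, 0).  The first one has neither end of the path
   next to the hole, the second one only the last vertex, the next three have
   both ends; the final one covers every hole next to the path.  The lists of
   steps were found by a computer search. *)
Definition hole_away_from_ends : state := [::
  Out (0, 0); In (1, 0); NotFirst (-1, 0); NotFirst (-1, 1);
  NotFirst (0, -1); NotFirst (0, 1); NotFirst (1, -1); NotFirst (1, 0);
  NotLast (-1, 0); NotLast (-1, 1); NotLast (0, -1); NotLast (0, 1);
  NotLast (1, -1); NotLast (1, 0)].

Definition hole_away_from_ends_cases : seq step := [::
  Member (2, 0); Succ (1, 0); Member (1, 1); Succ (1, 0); Pred (1, 0);
  Member (0, 1); Succ (1, 0); Pred (1, 0); Member (1, -1); Pred (1, -1);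
  Succ (1, -1); Pred (1, 0); Member (1, -1); Succ (1, -1); Pred (1, -1);
  Member (0, 2); Succ (0, 1); Member (-1, 2); Succ (0, 1); Pred (0, 1);
  Member (-2, 2); Member (-1, 1); Succ (0, 1); Pred (0, 1); Pred (-1, 2);
  Succ (-1, 2); Succ (1, 0); Pred (1, 0); Succ (-1, 2); Pred (-1, 2);
  Swap (0, 1) (0, 2) (-1, 2) (-1, 1); Pred (0, 1); Pred (1, 0); Succ (1, 0);
  Succ (-1, 1); Member (-2, 1); Member (-1, 1); Succ (0, 1); Pred (0, 1);
  Succ (1, 0); Pred (1, 0); Pred (0, 1); Pred (1, 0); Succ (1, 0);
  Succ (-1, 1); Pred (-1, 1); Member (-1, 1); Succ (0, 1); Pred (0, 1);
  Succ (1, 0); Pred (1, 0); Pred (0, 1); Pred (1, 0); Succ (1, 0);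
  Member (-2, 0); Member (-1, 0); Succ (-1, 1); Pred (-1, 1); Pred (-2, 1);
  Succ (-2, 1); Succ (0, 1); Pred (0, 1); Succ (-2, 1); Pred (-2, 1);
  Swap (-1, 1) (-2, 2) (-2, 1) (-1, 0); Pred (-1, 1); Pred (0, 1);
  Succ (0, 1); Succ (-1, 0); Member (-1, 0); Succ (-1, 1); Pred (-1, 1);
  Succ (0, 1); Pred (0, 1); Pred (-1, 1); Pred (0, 1); Succ (0, 1);
  Member (-1, -1); Succ (-1, 0); Pred (-1, 0); Member (0, -1); Succ (-1, 0);
  Pred (-1, 0); Succ (-1, 1); Pred (-1, 1); Pred (-1, 0); Pred (-1, 1);
  Succ (-1, 1); Member (0, -2); Succ (0, -1); Member (1, -2); Succ (0, -1);
  Pred (0, -1); Member (1, -1); Succ (0, -1); Succ (-1, 0); Pred (-1, 0);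
  Swap (0, -1) (-1, -1) (-1, 0) (0, 0); Pred (0, -1); Pred (-1, 0);
  Succ (-1, 0); Member (2, -2); Succ (1, -1); Member (2, -1); Succ (1, -1);
  Pred (1, -1); Succ (-1, 0); Succ (-1, 1); Pred (-1, 1); Pred (-1, 0);
  Pred (0, -1); Succ (0, -1); Succ (0, 1); Pred (0, 1); Pred (1, -1);
  Succ (1, -1); Succ (1, 0); Pred (1, 0); Pred (-1, 0); Pred (-1, 1);
  Succ (-1, 1); Pred (0, -1); Succ (0, -1); Succ (0, -1); Pred (0, -1);
  Pred (-1, 0); Pred (-1, 1); Succ (-1, 1); Pred (0, 1); Succ (0, 1);
  Succ (1, -1); Pred (1, -1); Succ (1, 0); Pred (1, 0)].

Definition hole_at_last : state := [::
  Out (0, 0); NotFirst (-1, 0); NotFirst (-1, 1); NotFirst (0, -1);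
  NotFirst (0, 1); NotFirst (1, -1); Last (1, 0)].

Definition hole_at_last_cases : seq step := [::
  Member (2, 0); Pred (1, 0); Member (1, 1); Pred (1, 0); Member (1, -1);
  Pred (1, -1); Succ (1, -1); Succ (2, 0); Pred (2, 0); Member (2, -2);
  Pred (2, -2); Swap (1, -1) (2, -1) (1, 0) (0, 0);
  Swap (1, -1) (2, -1) (1, 0) (0, 0); Succ (2, -2);
  Swap (1, -1) (2, -1) (1, 0) (0, 0); Member (0, -1); Pred (0, -1);
  Succ (0, -1); Swap (1, -1) (2, -1) (1, 0) (0, 0);
  Swap (1, -1) (2, -1) (1, 0) (0, 0); Member (0, 1); Pred (1, 0);
  Member (2, -1); Succ (1, 1); Pred (1, 1); Member (1, -1); Pred (2, -1);
  Succ (2, -1); Swap (2, -1) (2, 0) (1, 0) (1, -1); Pred (1, -1);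
  Member (2, -2); Member (0, -1); Pred (0, -1); Succ (0, -1); Succ (1, -1);
  Succ (2, -2); Swap (0, -1) (1, -2) (1, -1) (0, 0);
  Swap (0, -1) (1, -2) (1, -1) (0, 0); Pred (2, -2);
  Swap (0, -1) (1, -2) (1, -1) (0, 0); Swap (0, -1) (1, -2) (1, -1) (0, 0);
  Swap (1, -1) (2, -1) (2, -2) (1, -2); Swap (0, -1) (1, -2) (1, -1) (0, 0);
  Member (1, -2); Succ (1, -1); Member (0, -1); Pred (1, -2); Succ (1, -2);
  Succ (0, -1); Pred (0, -1); Member (-1, 0); Succ (-1, 0); Pred (-1, 0);
  Pred (0, -1); Member (-1, 0); Pred (-1, 0); Succ (-1, 0); Member (0, -1);
  Succ (0, -1); Pred (0, -1); Pred (1, 1); Member (0, 2); Succ (0, 2);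
  Pred (0, 2); Swap (1, 1) (1, 2) (0, 2) (0, 1);
  Swap (1, 1) (2, 0) (1, 0) (0, 1); Member (1, -1); Pred (1, -1);
  Succ (1, -1); Swap (1, -1) (2, -1) (1, 0) (0, 0); Member (0, 2);
  Succ (0, 1); Member (-1, 2); Succ (0, 1); Pred (0, 1); Member (-2, 2);
  Member (-1, 1); Succ (-1, 2); Succ (0, 1); Succ (0, 1); Pred (0, 1);
  Pred (-1, 2); Pred (1, 0); Member (2, -1); Member (1, -1); Pred (2, -1);
  Succ (2, -1); Swap (2, -1) (2, 0) (1, 0) (1, -1); Succ (1, -1);
  Pred (1, -1); Member (0, -1); Succ (0, -1); Pred (0, -1); Pred (1, -1);
  Member (0, -1); Pred (0, -1); Succ (0, -1); Member (1, -1); Pred (1, -1);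
  Succ (1, -1); Swap (1, -1) (2, -1) (1, 0) (0, 0); Succ (-1, 1);
  Member (-2, 1); Member (-1, 1); Succ (-2, 2); Succ (-1, 2); Succ (0, 1);
  Pred (-2, 2); Succ (-1, 2); Succ (0, 1); Succ (0, 1); Pred (0, 1);
  Pred (-1, 2); Pred (-1, 2); Succ (-1, 2); Succ (0, 1); Succ (0, 1);
  Pred (0, 1); Pred (1, 0); Member (2, -1); Member (1, -1); Pred (2, -1);
  Succ (2, -1); Swap (2, -1) (2, 0) (1, 0) (1, -1); Succ (1, -1);
  Pred (1, -1); Member (0, -1); Succ (0, -1); Pred (0, -1); Pred (1, -1);
  Member (0, -1); Pred (0, -1); Succ (0, -1); Member (1, -1); Pred (1, -1);
  Succ (1, -1); Swap (1, -1) (2, -1) (1, 0) (0, 0);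
  Cite 0 (Sym 0 false false (-1, 1)); Succ (-1, 1); Pred (-1, 1);
  Member (-1, 1); Succ (0, 1); Pred (0, 1); Succ (-1, 2); Pred (-1, 2);
  Member (-1, 0); Cite 0 (Sym 1 true false (-1, 0)); Succ (-2, 2);
  Succ (-2, 1); Succ (-1, 0); Pred (-1, 0); Pred (-2, 1); Succ (-1, 0);
  Succ (-2, 1); Succ (-1, 0); Succ (-2, 2); Succ (-2, 1); Pred (-2, 2);
  Pred (-1, 2); Swap (-1, 2) (-2, 3) (-2, 2) (-1, 1); Succ (-1, 2);
  Succ (-2, 2); Succ (-2, 1); Pred (-1, 2); Pred (-2, 1); Pred (-2, 2);
  Pred (0, 1); Swap (-1, 2) (-2, 3) (-2, 2) (-1, 1);
  Swap (0, 1) (0, 2) (-1, 2) (-1, 1); Member (-2, 0); Member (-1, 0);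
  Succ (-2, 1); Succ (-1, 1); Succ (-1, 1); Pred (-1, 1); Pred (-2, 1);
  Succ (0, 1); Pred (0, 1); Succ (-1, 0); Member (-1, 0); Succ (-1, 1);
  Pred (-1, 1); Succ (0, 1); Pred (0, 1); Succ (-2, 1); Succ (-2, 0);
  Pred (-2, 1); Pred (-2, 0); Pred (-1, 1);
  Swap (-2, 1) (-3, 1) (-2, 0) (-1, 0);
  Swap (-1, 1) (-2, 2) (-2, 1) (-1, 0); Member (-1, -1); Succ (-1, 0);
  Pred (-1, 0); Member (0, -1); Succ (-1, 0); Pred (-1, 0); Succ (-1, 1);
  Pred (-1, 1); Succ (-1, -1); Pred (-1, -1); Pred (-1, 0); Pred (-1, 1);
  Succ (-1, 1); Swap (-1, 0) (-2, 0) (-1, -1) (0, -1); Member (0, -2);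
  Succ (0, -1); Member (1, -2); Succ (0, -1); Pred (0, -1); Member (1, -1);
  Succ (0, -1); Succ (-1, 0); Pred (-1, 0);
  Swap (0, -1) (-1, -1) (-1, 0) (0, 0); Pred (0, -1); Pred (-1, 0);
  Succ (-1, 0); Member (2, -2); Succ (1, -1); Member (2, -1); Succ (1, -1);
  Pred (1, -1); Succ (-1, 0); Succ (-1, 1); Pred (-1, 1); Succ (-2, 2);
  Swap (-1, 0) (-2, 1) (-1, 1) (0, 0); Pred (-1, 0); Pred (0, -1);
  Succ (0, -1); Succ (-2, 0); Swap (-1, 0) (-2, 1) (-1, 1) (0, 0);
  Pred (-2, 0); Pred (-2, 2); Pred (0, -2);
  Swap (0, -1) (-1, -1) (-1, 0) (0, 0); Succ (0, -2); Succ (0, 1);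
  Pred (0, 1); Swap (0, -1) (-1, -1) (-1, 0) (0, 0);
  Swap (0, -1) (-1, -1) (-1, 0) (0, 0);
  Swap (0, -1) (-1, -1) (-1, 0) (0, 0); Swap (-1, 0) (-2, 1) (-1, 1) (0, 0);
  Swap (-1, 0) (-2, 1) (-1, 1) (0, 0); Swap (-1, 0) (-2, 1) (-1, 1) (0, 0);
  Swap (-1, 0) (-2, 1) (-1, 1) (0, 0); Swap (0, -1) (-1, -1) (-1, 0) (0, 0);
  Swap (-1, 0) (-2, 1) (-1, 1) (0, 0); Pred (-1, 0); Pred (-1, 1);
  Succ (-1, 1); Pred (0, -1); Succ (0, -1); Succ (0, -1); Pred (0, -1);
  Pred (-1, 0); Pred (-1, 1); Succ (-1, 1); Succ (-2, 0);
  Swap (-1, 1) (-2, 1) (-1, 0) (0, 0); Pred (-2, 0); Pred (-2, 2);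
  Swap (-1, 1) (-2, 1) (-1, 0) (0, 0); Succ (-2, 2); Succ (0, -2);
  Swap (-1, 0) (-1, -1) (0, -1) (0, 0); Pred (0, -2); Pred (0, 1);
  Succ (0, 1); Swap (-1, 0) (-1, -1) (0, -1) (0, 0);
  Swap (-1, 0) (-1, -1) (0, -1) (0, 0);
  Swap (-1, 0) (-1, -1) (0, -1) (0, 0); Swap (-1, 1) (-2, 1) (-1, 0) (0, 0);
  Swap (-1, 1) (-2, 1) (-1, 0) (0, 0); Swap (-1, 1) (-2, 1) (-1, 0) (0, 0);
  Swap (-1, 0) (-1, -1) (0, -1) (0, 0);
  Swap (-1, 0) (-1, -1) (0, -1) (0, 0); Swap (-1, 0) (-1, -1) (0, -1) (0, 0)].

(** Seen from the hole, the two ends are 60 degrees apart here, and 120 and 180 degrees apart in the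
    next two states. Up to symmetry these are all positions of two distinct neighbours. *)
Definition hole_at_ends1 : state := [::
  Out (0, 0); First (1, 0); Last (0, 1)].

(** The opening [Member] steps, each followed by a [Cite], dispose of a second hole nearby: an
    earlier state applies around that hole. The rest of the search may then take these points to lie
    on the path. The next two lists open in the same way. *)
Definition hole_at_ends1_cases : seq step := [::
  Member (0, 2); Cite 1 (Sym 3 true false (0, 2)); Member (-1, 2);
  Cite 1 (Sym 4 true false (-1, 2)); Member (-1, 1);
  Cite 1 (Sym 0 false false (-1, 1)); Member (-1, 0);
  Cite 0 (Sym 0 true false (-1, 0)); Member (0, -1);
  Cite 0 (Sym 1 true false (0, -1)); Member (1, -1);
  Cite 1 (Sym 0 true true (1, -1)); Member (2, -1);
  Cite 1 (Sym 1 true true (2, -1)); Member (2, 0);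
  Cite 1 (Sym 2 true true (2, 0)); Member (-2, 1); Succ (-1, 0);
  Pred (-1, 0); Member (-2, 2); Succ (-1, 1); Member (-2, 0); Succ (-1, 0);
  Member (-1, -1); Succ (-1, 0); Pred (-1, 0); Member (0, -2); Succ (0, -1);
  Member (1, -2); Succ (0, -1); Pred (0, -1); Member (1, 1); Pred (0, 1);
  Pred (-1, 1); Succ (-1, 1); Swap (-1, 1) (-1, 2) (0, 1) (0, 0);
  Cite 1 (Sym 4 true false (-1, 2)); Member (2, -2); Succ (1, -1);
  Succ (-1, 0); Succ (-1, 1); Pred (-1, 1); Succ (-2, 2);
  Swap (-1, 0) (-2, 1) (-1, 1) (0, 0); Pred (-2, 2);
  Swap (-1, 0) (-2, 1) (-1, 1) (0, 0); Swap (-1, 1) (-1, 2) (-2, 2) (-2, 1);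
  Cite 1 (Sym 4 true false (-1, 2)); Swap (-1, 0) (-2, 1) (-1, 1) (0, 0);
  Swap (-1, 0) (-2, 1) (-1, 1) (0, 0); Swap (-1, 0) (-2, 1) (-1, 1) (0, 0);
  Pred (-1, 0); Pred (-1, 1); Succ (-1, 1); Pred (0, -1); Succ (0, -1);
  Succ (0, -1); Pred (0, -1); Pred (-1, 0); Pred (-2, 0);
  Swap (-1, 0) (-1, -1) (0, -1) (0, 0); Succ (-2, 0); Pred (-1, 1);
  Succ (-1, 1); Swap (-1, 0) (-1, -1) (0, -1) (0, 0);
  Swap (-1, 0) (-1, -1) (0, -1) (0, 0); Swap (-1, 0) (-1, -1) (0, -1) (0, 0)].

Definition hole_at_ends2 : state := [::
  Out (0, 0); First (1, 0); Last (-1, 1)].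

Definition hole_at_ends2_cases : seq step := [::
  Member (-1, 2); Cite 1 (Sym 3 true false (-1, 2)); Member (-1, 0);
  Cite 1 (Sym 0 true false (-1, 0)); Member (0, -1);
  Cite 0 (Sym 1 true false (0, -1)); Member (0, 2);
  Cite 0 (Sym 2 true false (0, 2)); Member (1, -1);
  Cite 1 (Sym 0 true true (1, -1)); Member (1, 1);
  Cite 1 (Sym 3 true true (1, 1)); Member (-2, 1); Succ (-1, 0);
  Pred (-1, 0); Member (-2, 2); Pred (-1, 1); Member (-2, 0); Succ (-1, 0);
  Member (-1, -1); Succ (-1, 0); Pred (-1, 0); Member (0, -2); Succ (0, -1);
  Member (0, 1); Pred (-1, 1); Pred (-1, 2); Succ (-1, 2);
  Swap (-1, 2) (-2, 2) (-1, 1) (0, 1); Pred (-1, 0); Succ (-1, 0);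
  Swap (-1, 0) (-2, 1) (-1, 1) (0, 0); Member (1, -2); Succ (0, -1);
  Pred (0, -1); Member (2, -2); Succ (1, -1); Member (2, -1); Succ (1, -1);
  Pred (1, -1); Member (2, 0); Succ (1, 0); Succ (-1, 0); Pred (-1, 0);
  Pred (-1, 1); Pred (0, 1); Succ (0, 1);
  Swap (0, 1) (-1, 2) (-1, 1) (0, 0); Cite 1 (Sym 3 true false (-1, 2));
  Succ (0, -1); Pred (0, -1); Pred (1, -1); Succ (1, -1); Pred (0, -1);
  Succ (1, -1); Pred (1, -1); Pred (0, -1); Succ (0, -1); Succ (-2, 0);
  Swap (0, -1) (-1, -1) (-1, 0) (0, 0); Pred (-2, 0); Pred (0, -2);
  Swap (0, -1) (-1, -1) (-1, 0) (0, 0); Succ (0, -2); Pred (1, -1);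
  Succ (1, -1); Swap (0, -1) (-1, -1) (-1, 0) (0, 0);
  Swap (0, -1) (-1, -1) (-1, 0) (0, 0);
  Swap (0, -1) (-1, -1) (-1, 0) (0, 0);
  Swap (0, -1) (-1, -1) (-1, 0) (0, 0);
  Swap (0, -1) (-1, -1) (-1, 0) (0, 0);
  Swap (0, -1) (-1, -1) (-1, 0) (0, 0); Pred (-1, 0); Pred (-1, 1);
  Pred (0, 1); Succ (0, 1); Swap (0, 1) (-1, 2) (-1, 1) (0, 0);
  Cite 1 (Sym 3 true false (-1, 2)); Pred (0, -1); Succ (0, -1);
  Succ (0, -1); Pred (0, -1); Pred (-1, 0); Pred (-2, 0);
  Swap (-1, 0) (-1, -1) (0, -1) (0, 0); Succ (-2, 0); Pred (-1, 1);
  Succ (0, -2); Swap (-1, 0) (-1, -1) (0, -1) (0, 0); Pred (0, -2);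
  Pred (0, 1); Succ (0, 1); Swap (0, 1) (-1, 2) (-1, 1) (0, 0);
  Cite 1 (Sym 3 true false (-1, 2)); Swap (-1, 0) (-1, -1) (0, -1) (0, 0);
  Swap (-1, 0) (-1, -1) (0, -1) (0, 0);
  Swap (-1, 0) (-1, -1) (0, -1) (0, 0);
  Swap (-1, 0) (-1, -1) (0, -1) (0, 0);
  Swap (-1, 0) (-1, -1) (0, -1) (0, 0); Swap (-1, 0) (-1, -1) (0, -1) (0, 0)].

Definition hole_at_ends3 : state := [::
  Out (0, 0); First (1, 0); Last (-1, 0)].

Definition hole_at_ends3_cases : seq step := [::
  Member (-1, 1); Cite 1 (Sym 3 true false (-1, 1)); Member (0, -1);
  Cite 1 (Sym 1 true false (0, -1)); Member (0, 1);
  Cite 1 (Sym 4 true true (0, 1)); Member (-1, 2);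
  Cite 0 (Sym 3 true false (-1, 2)); Member (1, -1);
  Cite 1 (Sym 0 true true (1, -1)); Member (1, -2);
  Cite 0 (Sym 0 true false (1, -2)); Member (-2, 1); Pred (-1, 0);
  Succ (-1, 1); Pred (-1, 1); Member (-2, 2); Succ (-1, 1); Member (-2, 0);
  Pred (-1, 0); Member (-1, -1); Pred (-1, 0); Pred (-2, 0); Succ (-2, 0);
  Succ (-1, 1); Pred (-1, 1); Swap (-2, 0) (-2, 1) (-1, 0) (-1, -1);
  Member (0, -2); Succ (0, -1); Member (0, 2); Succ (0, 1); Member (1, 1);
  Succ (0, 1); Pred (0, 1); Member (2, -2); Succ (1, -1); Member (2, -1);
  Succ (1, -1); Pred (1, -1); Member (2, 0); Succ (1, 0); Pred (-1, 0);
  Pred (-1, 1); Succ (-1, 1); Pred (-2, 2);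
  Swap (-1, 1) (-2, 1) (-1, 0) (0, 0); Succ (-2, 2);
  Swap (-1, 1) (-2, 1) (-1, 0) (0, 0); Swap (-2, 2) (-1, 2) (-1, 1) (-2, 1);
  Cite 0 (Sym 0 false false (-1, 2)); Swap (-1, 1) (-2, 1) (-1, 0) (0, 0);
  Swap (-1, 1) (-2, 1) (-1, 0) (0, 0); Swap (-1, 1) (-2, 1) (-1, 0) (0, 0);
  Pred (-1, 1); Pred (0, 1); Succ (0, 1);
  Swap (0, 1) (-1, 2) (-1, 1) (0, 0); Cite 0 (Sym 0 false false (-1, 2));
  Succ (-1, 1); Succ (0, 1); Pred (0, 1); Succ (0, -1); Pred (0, -1);
  Pred (1, -1); Succ (1, -1); Pred (0, -1); Succ (1, -1); Pred (1, -1);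
  Pred (0, -1); Succ (0, -1); Pred (0, -2);
  Swap (0, -1) (-1, -1) (-1, 0) (0, 0); Succ (0, -2);
  Swap (0, -1) (-1, -1) (-1, 0) (0, 0);
  Swap (0, -2) (1, -2) (0, -1) (-1, -1); Cite 0 (Sym 0 false false (1, -2));
  Swap (0, -1) (-1, -1) (-1, 0) (0, 0);
  Swap (0, -1) (-1, -1) (-1, 0) (0, 0); Swap (0, -1) (-1, -1) (-1, 0) (0, 0)].

Definition hole_near_path : state := [::
  Out (0, 0); In (1, 0)].

Definition hole_near_path_cases : seq step := [::
  IsFirst (1, 0); IsLast (0, 1); Cite 2 (Sym 0 false false (0, 0));
  IsLast (-1, 1); Cite 3 (Sym 0 false false (0, 0)); IsLast (-1, 0);
  Cite 4 (Sym 0 false false (0, 0)); IsLast (0, -1);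
  Cite 3 (Sym 4 false true (0, 0)); IsLast (1, -1);
  Cite 2 (Sym 5 false true (0, 0)); Cite 1 (Sym 0 false true (0, 0));
  IsFirst (0, 1); IsLast (1, 0); Cite 2 (Sym 0 false true (0, 0));
  IsLast (-1, 1); Cite 2 (Sym 1 false false (0, 0)); IsLast (-1, 0);
  Cite 3 (Sym 1 false false (0, 0)); IsLast (0, -1);
  Cite 4 (Sym 0 true false (0, 0)); IsLast (1, -1);
  Cite 3 (Sym 0 true false (0, 0)); Cite 1 (Sym 0 true true (0, 0));
  IsFirst (-1, 1); IsLast (1, 0); Cite 3 (Sym 0 false true (0, 0));
  IsLast (0, 1); Cite 2 (Sym 1 false true (0, 0)); IsLast (-1, 0);
  Cite 2 (Sym 2 false false (0, 0)); IsLast (0, -1);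
  Cite 3 (Sym 2 false false (0, 0)); IsLast (1, -1);
  Cite 4 (Sym 1 true false (0, 0)); Cite 1 (Sym 1 true true (0, 0));
  IsFirst (-1, 0); IsLast (1, 0); Cite 4 (Sym 0 false true (0, 0));
  IsLast (0, 1); Cite 3 (Sym 1 false true (0, 0)); IsLast (-1, 1);
  Cite 2 (Sym 2 false true (0, 0)); IsLast (0, -1);
  Cite 2 (Sym 3 false false (0, 0)); IsLast (1, -1);
  Cite 3 (Sym 3 false false (0, 0)); Cite 1 (Sym 2 true true (0, 0));
  IsFirst (0, -1); IsLast (1, 0); Cite 3 (Sym 4 false false (0, 0));
  IsLast (0, 1); Cite 4 (Sym 0 true true (0, 0)); IsLast (-1, 1);
  Cite 3 (Sym 2 false true (0, 0)); IsLast (-1, 0);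
  Cite 2 (Sym 3 false true (0, 0)); IsLast (1, -1);
  Cite 2 (Sym 4 false false (0, 0)); Cite 1 (Sym 3 true true (0, 0));
  IsFirst (1, -1); IsLast (1, 0); Cite 2 (Sym 5 false false (0, 0));
  IsLast (0, 1); Cite 3 (Sym 0 true true (0, 0)); IsLast (-1, 1);
  Cite 4 (Sym 1 true true (0, 0)); IsLast (-1, 0);
  Cite 3 (Sym 3 false true (0, 0)); IsLast (0, -1);
  Cite 2 (Sym 4 false true (0, 0)); Cite 1 (Sym 4 true true (0, 0));
  IsLast (1, 0); Cite 1 (Sym 0 false false (0, 0)); IsLast (0, 1);
  Cite 1 (Sym 0 true false (0, 0)); IsLast (-1, 1);
  Cite 1 (Sym 1 true false (0, 0)); IsLast (-1, 0);
  Cite 1 (Sym 2 true false (0, 0)); IsLast (0, -1);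
  Cite 1 (Sym 3 true false (0, 0)); IsLast (1, -1);
  Cite 1 (Sym 4 true false (0, 0)); Cite 0 (Sym 0 false false (0, 0))].

Local Close Scope int_scope.

Lemma valid_cases (T : eqType) (e : rel T) known prog st :
  symmetric e -> run known prog [:: st] -> all_valid e known -> valid e st.
Proof. by move=> es h vk; case: (runP es vk h). Qed.

Lemma hole_away_from_ends_checked :
  run [::] hole_away_from_ends_cases [:: hole_away_from_ends].
Proof. by vm_compute. Qed.

Lemma hole_at_last_checked :
  run [:: hole_away_from_ends]
    hole_at_last_cases [:: hole_at_last].
Proof. by vm_compute. Qed.

Lemma hole_at_ends1_checked :
  run [:: hole_away_from_ends; hole_at_last]
    hole_at_ends1_cases [:: hole_at_ends1].
Proof. by vm_compute. Qed.

Lemma hole_at_ends2_checked :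
  run [:: hole_away_from_ends; hole_at_last; hole_at_ends1]
    hole_at_ends2_cases [:: hole_at_ends2].
Proof. by vm_compute. Qed.

Lemma hole_at_ends3_checked :
  run [:: hole_away_from_ends; hole_at_last; hole_at_ends1; hole_at_ends2]
    hole_at_ends3_cases [:: hole_at_ends3].
Proof. by vm_compute. Qed.

Lemma hole_near_path_checked :
  run [:: hole_away_from_ends; hole_at_last; hole_at_ends1; hole_at_ends2; hole_at_ends3]
    hole_near_path_cases [:: hole_near_path].
Proof. by vm_compute. Qed.

Lemma valid_hole (T : eqType) (e : rel T) : symmetric e -> valid e hole_near_path.
Proof.
move=> es.
have v0 := valid_cases es hole_away_from_ends_checked I.
have v1 := valid_cases es hole_at_last_checked (conj v0 I).
have v2 := valid_cases es hole_at_ends1_checked (conj v0 (conj v1 I)).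
have v3 := valid_cases es hole_at_ends2_checked (conj v0 (conj v1 (conj v2 I))).
have v4 := valid_cases es hole_at_ends3_checked (conj v0 (conj v1 (conj v2 (conj v3 I)))).
exact: (valid_cases es hole_near_path_checked (conj v0 (conj v1 (conj v2 (conj v3 (conj v4 I)))))).
Qed.

(** * Units and residues of Eisenstein integers *)

Definition eis_of (p : pt) : eisenstein := Eis p.1 p.2.

Lemma pnorm1_units d : pnorm d = 1 -> d \in units.
Proof.
case: d => x y; rewrite /pnorm /= => h.
(* Four times the norm is [(2x + y)^2 + 3y^2], hence [3y^2 <= 4]; likewise for [x]. *)
have [hy1 hy2] : y <= 1 /\ -1 <= y by split; nia.
have [hx1 hx2] : x <= 1 /\ -1 <= x by split; nia.
have : x \in [:: -1; 0; 1] by rewrite !inE; lia.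
have : y \in [:: -1; 0; 1] by rewrite !inE; lia.
by rewrite !inE => /or3P[] /eqP yE /or3P[] /eqP xE; move: h; rewrite xE yE.
Qed.

Lemma small_multiple (k : int) (d x y : nat) :
  x%:Z - y%:Z = k * d%:Z -> (x < d)%N -> (y < d)%N -> x = y.
Proof.
move=> e xd yd; have [k0|k1|k0] := ltgtP k 0.
- have : k * d%:Z <= - d%:Z by nia.
  by lia.
- have : d%:Z <= k * d%:Z by nia.
  by lia.
by move: e; rewrite k0 mul0r; lia.
Qed.

(** The last two hypotheses say that the difference is [p + q * rho] times [d * (a + b * rho)]. Its
    second coordinate is a multiple of [d], hence zero, so [p * b = - q * (a + b)]. By coprimality
    [q = t * b] and [p = - t * (a + b)], and the first coordinate becomes [- t] times the bound on
    [i] and [i'], hence zero too. *)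
Lemma residues_inj (a b d i j i' j' : nat) (p q : int) :
    coprime a b -> (0 < b)%N ->
    (i < (a * a + a * b + b * b) * d)%N -> (i' < (a * a + a * b + b * b) * d)%N ->
    (j < d)%N -> (j' < d)%N ->
    i%:Z - i'%:Z = p * (a * d)%:Z - q * (b * d)%:Z ->
    j%:Z - j'%:Z = p * (b * d)%:Z + q * (a * d)%:Z + q * (b * d)%:Z ->
  i = i' /\ j = j'.
Proof.
move=> cab b0 im i'm jd j'd ei ej.
have ejj : j = j'.
  apply: (@small_multiple (p * b%:Z + q * (a + b)%:Z) d) => //.
  by rewrite ej !PoszM PoszD; ring.
split=> //; move: ej; rewrite ejj subrr => ej.
have d0 : d%:Z != 0 by case: d jd {im i'm j'd ei ej}.
have bz : b%:Z != 0 by case: b b0 {cab im i'm ei ej}.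
have {}ej : p * b%:Z = - q * (a + b)%:Z.
  apply: (mulIf d0); apply/eqP; rewrite -subr_eq0 [X in _ == X]ej !PoszM PoszD.
  by apply/eqP; ring.
have /dvdzP[t qt] : (b %| q)%Z.
  rewrite -(@Gauss_dvdzl _ _ (a + b)%:Z); last first.
    by rewrite coprimezE /= /coprime gcdnDr gcdnC.
  by apply/dvdzP; exists (- p); rewrite mulNr ej mulNr opprK.
have pt : p = - t * (a + b)%:Z.
  by apply: (mulIf bz); rewrite ej qt; ring.
apply: (@small_multiple (- t) ((a * a + a * b + b * b) * d)) => //.
by rewrite ei pt qt !PoszM !PoszD !PoszM; ring.
Qed.

(* [has] evaluates all its tests under vm_compute; this variant stops at the
   first success. *)
Fixpoint lazy_has (I : Type) (P : pred I) (s : seq I) : bool :=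
  if s is x :: s' then if P x then true else lazy_has P s' else false.

Lemma lazy_hasE (I : Type) (P : pred I) s : lazy_has P s = has P s.
Proof. by elim: s => //= x s ->; case: (P x). Qed.

(** * The network as a quotient of the lattice *)

Section Network.

Variables (a b : int).
Hypotheses (ha : 0 <= a) (hab : a <= b) (h0 : Eis a b != 0).
Let alpha := Eis a b.
Let n : int := pnorm (a, b).

Lemma size_gt0 : 0 < n.
Proof.
have b0 : b != 0.
  apply: contraNneq h0 => eb; move: hab; rewrite eb => a0.
  by rewrite (le_anti (introT andP (conj a0 ha))).
by rewrite /n /pnorm /=; nia.
Qed.

Lemma pnormM (w z : eisenstein) :
  pnorm (eis1 (w * z), eisrho (w * z)) = pnorm (eis1 w, eisrho w) * pnorm (eis1 z, eisrho z).
Proof. by case: w z => [x y] [x' y']; rewrite /pnorm /=; ring. Qed.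

Lemma pi_eq (x y : eisenstein) :
  (\pi_(EJ alpha) x == \pi_(EJ alpha) y) = `[< exists w, x - y = w * alpha >].
Proof. by rewrite -Quotient.idealrBE. Qed.

Notation pi := (\pi_(EJ alpha)).

Lemma EJ_adjP (u v : EJ alpha) :
  reflect (exists2 d, d \in units & u - v = pi (eis_of d)) (EJ_adj u v).
Proof.
have E : [:: 1; -1; rho; - rho; rho ^+ 2; - rho ^+ 2] =
  map eis_of [:: (1, 0); (-1, 0); (0, 1); (0, -1); (-1, 1); (1, -1)] by [].
rewrite /EJ_adj E -map_comp.
apply: (iffP mapP) => -[d du ->]; exists d => //; move: du; rewrite !inE.
  by do 5 (case/orP; first by move=> /eqP->); move/eqP->.
by do 5 (case/orP; first by move=> /eqP->); move/eqP->.
Qed.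

Lemma EJ_adj_sym : symmetric (@EJ_adj alpha).
Proof.
suff h u v : @EJ_adj alpha u v -> EJ_adj v u by move=> u v; apply/idP/idP; exact: h.
case/EJ_adjP=> d du e; apply/EJ_adjP; exists (- d.1, - d.2).
  by move: du; rewrite !inE; do 5 (case/orP; first by move=> /eqP->); move/eqP->.
by rewrite -opprB e -raddfN.
Qed.

(** Lattice coordinates on the network, with the class of [z] at the origin. *)
Definition chart (z : eisenstein) (p : pt) : EJ alpha := pi (z + eis_of p).

Lemma chartB z p q : chart z p - chart z q = pi (eis_of (psub p q)).
Proof.
rewrite /chart -raddfB opprD addrACA subrr add0r; congr (pi _).
Qed.

(** Two distinct points with the same image differ by a nonzero multiple of [alpha], whose norm is
    at least [n] by multiplicativity. With [9 < n] this excludes points related by [sep]. *)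
Lemma chart_lattice_map z : 9 < n -> lattice_map (@EJ_adj alpha) (chart z).
Proof.
move=> n9; split=> [p q /eqP pq|p y|p q].
- rewrite EJ_adj_sym; apply/EJ_adjP; exists (psub q p); last exact: chartB.
  exact: pnorm1_units.
- rewrite EJ_adj_sym => /EJ_adjP[d du e]; exists d => //.
  by rewrite -[y](subrK (chart z p)) e /chart -raddfD addrC -addrA.
case/andP=> N0 N9 /eqP; rewrite /chart pi_eq => /asboolP[w].
rewrite opprD addrACA subrr add0r => e.
have : pnorm (psub p q) = pnorm (eis1 w, eisrho w) * n.
  by rewrite -(pnormM w alpha) -e.
case: (lerP (pnorm (eis1 w, eisrho w)) 0) => [M0|M1] eN.
  by move: N0; rewrite eN ltNge mulr_le0_ge0 // ltW // (lt_trans _ n9).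
have n0 : 0 < n by exact: lt_trans n9.
have : n <= pnorm (psub p q) by rewrite eN ler_peMl // ltW.
by rewrite leNgt (le_lt_trans N9 n9).
Qed.

(** Applied to a route from [u] to a missed vertex, this yields a hole adjacent to the path. *)
Lemma boundary (T : eqType) (e : rel T) (s : seq T) x p :
  path e x p -> x \in s -> last x p \notin s ->
  exists y z, [/\ y \in s, z \notin s & e y z].
Proof.
elim: p x => [|y p IH] x /=; first by move=> _ ->.
case/andP=> xy py xs; have [ys|ys _] := boolP (y \in s); first exact: IH.
by exists x, y.
Qed.

Lemma uvpathE (u v : EJ alpha) p : uvpath (@EJ_adj alpha) u v (u :: p) = EJ_path u v p.
Proof.
rewrite /uvpath /EJ_path -[u :: p]cat0s ohead_rev_cat /= eqxx /=.
by rewrite [_ && (_ == _)]andbC; congr andb; rewrite andbC.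
Qed.

Lemma extend_path (u v : EJ alpha) p : 9 < n -> u <> v -> EJ_path u v p ->
  (exists x, x \notin u :: p) -> exists2 p', EJ_path u v p' & size p' = (size p).+1.
Proof.
move=> n9 uv; rewrite -uvpathE; set s := u :: p => ps [x xs].
have [q qs lq] : exists2 q, path (@EJ_adj alpha) u q & last u q = x.
  have [l /asboolP[q /and3P[pq /eqP lq _] _]] := EJ_connected u x.
  by exists q.
have [y [z [ys zs yz]]] : exists y z, [/\ y \in s, z \notin s & EJ_adj y z].
  by apply: (boundary qs); rewrite ?mem_head ?lq.
have cz := chart_lattice_map (repr z) n9.
have c0 : chart (repr z) (0, 0) = z by rewrite /chart (_ : eis_of _ = 0) ?addr0 ?reprK.
have [d du yd] : exists2 d, d \in units & y = chart (repr z) d.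
  have := lattice_nbr cz (p := (0, 0)) (y := y); rewrite c0 EJ_adj_sym => /(_ yz).
  by case=> d du ->; exists d => //; rewrite /padd /= !add0r -surjective_pairing.
(* The chart puts the hole [z] at the origin and the path vertex [y] at a unit [d]. Precomposing it
   with a power of [rotate] brings [y] to [(1, 0)], as [hole_near_path] requires. *)
have [k dk] : exists k, d = iter k rotate (1, 0).
  move: du; rewrite !inE; do 5 (case/orP; first by move=> /eqP->;
    solve [by exists 0%N|by exists 1%N|by exists 2%N|by exists 3%N
          |by exists 4%N|by exists 5%N]).
  by move/eqP->; exists 5%N.
have ck := lattice_map_iter k (@lattice_map_rotate _ _) cz.
have k0 : iter k rotate (0, 0) = (0, 0) by elim: (k) => //= ? ->.
have [|s' ps' ss'] := valid_hole EJ_adj_sym uv ck ps.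
  by rewrite /= k0 c0 -dk -yd.
case: s' ps' ss' => [|u' s'] //= ps' [ss']; exists s' => //.
have /and4P[_ _ /eqP[eu] _] := ps'.
by rewrite -uvpathE; rewrite eu in ps'.
Qed.


(* The points (i, j) with j < d and i < n / d, for d = gcd(a, b), are pairwise
   incongruent, so there are at least n nodes. *)
Lemma exists_outside (s : seq (EJ alpha)) : (size s)%:Z < n -> exists x, x \notin s.
Proof.
have [A eA] : exists A : nat, a = A%:Z by exists `|a|%N; rewrite gez0_abs.
have [B eB] : exists B : nat, b = B%:Z.
  by exists `|b|%N; rewrite gez0_abs // (le_trans ha hab).
have B0 : (0 < B)%N.
  by move: hab size_gt0; rewrite /n eA eB /pnorm /=; case: B {eB} => // A0; nia.
pose d := gcdn A B; have d0 : (0 < d)%N by rewrite gcdn_gt0 B0 orbT.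
have [A' eA'] : exists A', A = (A' * d)%N by apply/dvdnP/dvdn_gcdl.
have [B' eB'] : exists B', B = (B' * d)%N by apply/dvdnP/dvdn_gcdr.
have cAB : coprime A' B'.
  by rewrite /coprime -(eqn_pmul2r d0) mul1n muln_gcdl -eA' -eB'.
have B'0 : (0 < B')%N by move: B0; rewrite eB' muln_gt0 => /andP[].
pose m := ((A' * A' + A' * B' + B' * B') * d)%N.
pose L := [seq (pi (Eis i%:Z j%:Z) : EJ alpha) | i <- iota 0 m, j <- iota 0 d].
have uL : uniq L.
  apply: allpairs_uniq; rewrite ?iota_uniq // => -[i j] [i' j'].
  case/allpairsP=> -[x y] /=; rewrite !mem_iota /= => -[xm yd [-> ->]].
  case/allpairsP=> -[x' y'] /=; rewrite !mem_iota /= => -[xm' yd' [-> ->]].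
  move/eqP; rewrite pi_eq => /asboolP[[p q] []].
  rewrite eA eB eA' eB' => ei ej.
  by have [|-> ->] := residues_inj cAB B'0 xm xm' yd yd' ei; first by rewrite ej; ring.
have sL : (size L)%:Z = n.
  rewrite size_allpairs !size_iota /m /n /pnorm /= eA eB eA' eB' !PoszM !PoszD !PoszM.
  by ring.
rewrite -sL ltz_nat => sz; have [/allP h|] := boolP (all (mem s) L).
  by move: sz; rewrite ltnNge uniq_leq_size.
by case/allPn=> x _ xs; exists x.
Qed.

Lemma path_step (u v : EJ alpha) k : 9 < n -> u <> v -> (k.+1)%:Z < n ->
  EJ_path_length u v k -> EJ_path_length u v k.+1.
Proof.
(* A path with [k] edges visits [k.+1] nodes, fewer than [n]. *)
move=> n9 uv kn [p pp pk]; have [|x xs] := @exists_outside (u :: p).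
  by rewrite /= pk.
have [|p' pp' pk'] := extend_path n9 uv pp; first by exists x.
by exists p'; rewrite // pk' pk.
Qed.

(* Exhaustive search, for the networks in which nearby lattice points collide. *)
Definition congruent (p q : pt) : bool :=
  let d := psub p q in
  (n %| d.1 * (a + b) + d.2 * b)%Z && (n %| d.2 * a - d.1 * b)%Z.

(** Nodes are represented by lattice points and compared by [congruent], so the search is integer
    arithmetic and can be evaluated, unlike equality in the quotient. *)
Fixpoint walk (l : nat) (seen : seq pt) (p q : pt) : bool :=
  if l is l'.+1 then
    lazy_has (fun d => let p' := padd p d in
      if has (congruent p') seen then false else walk l' (p' :: seen) p' q) units
  else congruent p q.

(** Division by [alpha] is multiplication by its conjugate [(a + b) - b * rho] followed by division
    by [n]. The two divisibilities in [congruent] concern the coordinates of that product. *)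
Lemma congruentP z p q : reflect (chart z p = chart z q) (congruent p q).
Proof.
have n0 := size_gt0.
apply: (iffP andP) => [[/dvdzP[x ex] /dvdzP[y ey]]|/eqP].
  apply/eqP; rewrite /chart pi_eq opprD addrACA subrr add0r; apply/asboolP.
  exists (Eis x y); move: ex ey; rewrite /psub /=; case: p q => [p1 p2] [q1 q2] /= ex ey.
  congr Eis => /=; apply: (mulIf (lt0r_neq0 n0)).
    transitivity (x * n * a - y * n * b); last by ring.
    by rewrite -ex -ey /n /pnorm /=; ring.
  transitivity (x * n * b + y * n * a + y * n * b); last by ring.
  by rewrite -ex -ey /n /pnorm /=; ring.
rewrite /chart pi_eq opprD addrACA subrr add0r => /asboolP[[x y] e].
have [e1 e2] : (psub p q).1 = x * a - y * b /\ (psub p q).2 = x * b + y * a + y * b.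
  by case: e.
rewrite e1 e2; split; apply/dvdzP.
  by exists x; rewrite /n /pnorm /=; ring.
by exists y; rewrite /n /pnorm /=; ring.
Qed.

Lemma walkP z l seen p q : walk l seen p q -> exists r : seq (EJ alpha),
  [/\ path (@EJ_adj alpha) (chart z p) r, last (chart z p) r = chart z q,
      size r = l, uniq r & {in r, forall x, x \notin map (chart z) seen}].
Proof.
elim: l seen p => [|l IH] seen p h; first by exists [::]; split=> //=; apply/congruentP.
have /hasP[d du] : has (fun d => if has (congruent (padd p d)) seen then false
  else walk l (padd p d :: seen) (padd p d) q) units.
  by rewrite -lazy_hasE; exact: h.
case: ifPn => // /hasP new /IH[r [pr lr sr ur nr]].
exists (chart z (padd p d) :: r); split=> //=; last 2 first.
- rewrite ur andbT; apply/negP=> /nr; by rewrite mem_head.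
- move=> x; rewrite inE => /orP[/eqP->|/nr]; last by rewrite inE negb_or => /andP[].
  by apply/mapP=> -[t ts /congruentP e]; apply: new; exists t.
- rewrite pr andbT EJ_adj_sym; apply/EJ_adjP; exists d => //.
  by rewrite chartB; congr (pi _); case: (p) (d) => [? ?] [? ?]; congr Eis => /=; ring.
by rewrite sr.
Qed.

(* The congruence in the first line makes [0, k)^2 meet every residue class. *)
Definition all_walks (k : nat) : bool :=
  congruent (k%:Z, 0) (0, 0) &&
  all (fun x => all (fun y => if congruent (x%:Z, y%:Z) (0, 0) then true else
    all (fun l => walk l [:: (0, 0)] (0, 0) (x%:Z, y%:Z)) (iota 2 (`|n| - 2)%N))
  (iota 0 k)) (iota 0 k).

Lemma all_walksP k (u v : EJ alpha) l : all_walks k -> (0 < k)%N -> u <> v ->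
  (2 <= l)%N -> l%:Z < n -> EJ_path_length u v l.
Proof.
case/andP=> /(congruentP 0) ck walks k0 uv l2 ln.
set z := repr u; have z0 : chart z (0, 0) = u.
  by rewrite /chart (_ : eis_of _ = 0) ?addr0 ?reprK.
pose w := repr v - z.
have vw : v = pi (z + w) by rewrite /w addrC subrK reprK.
have kz : k%:Z != 0 by case: k k0 {ck walks}.
have [x ex] : exists x : nat, x%:Z = (eis1 w %% k%:Z)%Z.
  by exists `|(eis1 w %% k%:Z)%Z|%N; rewrite gez0_abs // modz_ge0.
have [y ey] : exists y : nat, y%:Z = (eisrho w %% k%:Z)%Z.
  by exists `|(eisrho w %% k%:Z)%Z|%N; rewrite gez0_abs // modz_ge0.
have vxy : v = chart z (x%:Z, y%:Z).
  move/eqP: ck; rewrite /chart pi_eq => /asboolP[t].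
  rewrite opprD addrACA subrr add0r subr0 => et.
  apply/eqP; rewrite vw /chart pi_eq opprD addrACA subrr add0r; apply/asboolP.
  (* Since [k = t * alpha], reducing both coordinates of [w] modulo [k] subtracts this multiple of
     [alpha]. *)
  exists (Eis (eis1 w %/ k%:Z)%Z (eisrho w %/ k%:Z)%Z * t).
  rewrite -mulrA -et; case: (w) ex ey => w1 w2 /= ex ey; congr Eis => /=.
    by rewrite {1}(divz_eq w1 k%:Z) ex; ring.
  by rewrite {1}(divz_eq w2 k%:Z) ey; ring.
have xk : x \in iota 0 k by rewrite mem_iota /= -ltz_nat ex ltz_pmod.
have yk : y \in iota 0 k by rewrite mem_iota /= -ltz_nat ey ltz_pmod.
have /allP/(_ y yk) := allP walks x xk.
case: ifP => [/(congruentP z) e _|_]; first by case: uv; rewrite vxy e z0.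
have lr : l \in iota 2 (`|n| - 2)%N by rewrite mem_iota l2 /=; lia.
move/allP/(_ l lr)/(walkP z) => [r [pr er sr ur nr]].
exists r => //; rewrite z0 -vxy in pr er nr *.
rewrite /EJ_path pr er eqxx /= ur andbT.
by apply/negP=> /nr; rewrite /= inE z0 eqxx.
Qed.

End Network.

(** * The five small networks and the conclusion *)

(** In each of the five searches the last argument is the least positive integer divisible by
    [alpha], namely [n] divided by the gcd of [a] and [b]. *)
Lemma all_walks_0_1 : all_walks 0 1 1. Proof. by vm_compute. Qed.
Lemma all_walks_0_2 : all_walks 0 2 2. Proof. by vm_compute. Qed.
Lemma all_walks_0_3 : all_walks 0 3 3. Proof. by vm_compute. Qed.
Lemma all_walks_1_1 : all_walks 1 1 3. Proof. by vm_compute. Qed.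
Lemma all_walks_1_2 : all_walks 1 2 7. Proof. by vm_compute. Qed.

Theorem theorem1 (a b : int) (ha : 0 <= a) (hab : a <= b)
    (h0 : Eis a b != 0) (u v : EJ (Eis a b)) (huv : u <> v) (l : nat) :
  (EJ_dist u v <= l)%N ->
  l%:Z <= a ^+ 2 + b ^+ 2 + a * b - 1 ->
  exists p : seq (EJ (Eis a b)), EJ_path u v p /\ size p = l.
Proof.
move=> Dl ln.
suff [p pp sp] : EJ_path_length u v l by exists p.
have {}ln : l%:Z < pnorm (a, b).
  have -> : pnorm (a, b) = a ^+ 2 + b ^+ 2 + a * b by rewrite /pnorm /=; ring.
  by lia.
have pD : EJ_path_length u v (EJ_dist u v).
  by rewrite /EJ_dist; case: ex_minnP => D /asboolP.
have [n9|n9] := ltrP 9 (pnorm (a, b)).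
  elim: l Dl ln => [|l IH]; first by rewrite leqn0 => /eqP <-.
  rewrite leq_eqVlt => /orP[/eqP <- //|Dl] ln.
  by apply: path_step => //; apply: IH => //; lia.
move: Dl; rewrite leq_eqVlt => /orP[/eqP <- //|Dl].
(* The distance itself is already dealt with and is at least 1 as [u <> v]. In the small networks
   every length from 2 to [n - 1] occurs between any two distinct nodes, so the search can ignore
   distances. *)
have l2 : (2 <= l)%N.
  apply: leq_trans Dl; case: pD => p /and3P[_ /eqP lp _] <-.
  by case: p lp => //= e; case: huv.
have b3 : b <= 3 by move: n9 ha hab; rewrite /pnorm /=; clear; nia.
(* These are the admissible pairs of norm at most 9; their norms are 1, 4, 9, 3 and 7. *)
have : ((a, b) : pt) \in [:: (0, 1); (0, 2); (0, 3); (1, 1); (1, 2)].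
  have {}h0 : ~~ ((a == 0) && (b == 0)).
    by apply: contra h0 => /andP[/eqP-> /eqP->].
  have a4 : a \in [:: 0; 1; 2; 3] by rewrite !inE; lia.
  have b4 : b \in [:: 0; 1; 2; 3] by rewrite !inE; lia.
  move: a4 b4 ha hab h0 n9; clear; rewrite !inE.
  by move=> /or4P[] /eqP-> /or4P[] /eqP->.
rewrite !inE => /or4P[||| /orP[]] /eqP[ea eb]; subst a b.
- exact: (all_walksP ha hab h0 all_walks_0_1 isT huv l2 ln).
- exact: (all_walksP ha hab h0 all_walks_0_2 isT huv l2 ln).
- exact: (all_walksP ha hab h0 all_walks_0_3 isT huv l2 ln).
- exact: (all_walksP ha hab h0 all_walks_1_1 isT huv l2 ln).
- exact: (all_walksP ha hab h0 all_walks_1_2 isT huv l2 ln).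
Qed.
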